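(* Let $R:\mathbb{R}\to\mathbb{C}$ satisfy the following conditions: 1) $R$ is odd, $R(0)=0$; 2) $R(x)\to 0$ as $x\to+\infty$; 3) the integral $\displaystyle\int_0^\infty\frac{|R(x)|}{x}\,dx$ converges; 4) $R$ is absolutely continuous on every segment $[0,a]$, $a>0$; 5) $R'\in L_1(0,\infty)$; 6) there exists a number $b\ge 0$ such that (a) $\displaystyle\int_1^\infty\frac{|g(t)|}{t}\,dt<\infty$, where $\displaystyle g(t)=\int_0^b R'(x)\cos(xt)\,dx$; (b) there exists an extension of the (almost everywhere defined) derivative $R'$ to the whole real axis such that $R'$ has bounded variation on $[b,\infty)$ and $\displaystyle\int_b^\infty\Big(\bigvee_x^\infty R'\Big)\,dx<\infty$. Then $R\in\mathcal{F}(\mathbb{R})$.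
   Context: $\mathcal{F}(\mathbb{R})$ is the set (an algebra under pointwise operations) of all functions on $\mathbb{R}$ of the form $\widehat f(x)=\frac{1}{\sqrt{2\pi}}\int_{-\infty}^{\infty}f(t)e^{-ixt}\,dt$ with $f\in L_1(-\infty,\infty)$. The symbol $\bigvee_a^b f$ denotes the total variation of $f$ on the interval with endpoints $a,b$; $\bigvee_x^\infty f$ is the total variation on $[x,\infty)$. *)

(* Defs.v *)
From HB Require Import structures.
From mathcomp Require Import all_boot all_order all_algebra.
From mathcomp Require Import complex.
From mathcomp Require Import all_classical all_reals all_analysis.

Set Implicit Arguments.
Unset Strict Implicit.
Unset Printing Implicit Defensive.

Import Order.TTheory GRing.Theory Num.Theory.
Import numFieldNormedType.Exports.
Import ComplexField.Normc.

Local Open Scope classical_set_scope.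
Local Open Scope ring_scope.

(* Complex-valued functions of a real variable are maps K -> K[i]. The
   library's derivative, measurability and integral are for real-valued
   functions, and are lifted here through real and imaginary parts; the
   modulus is normc, which takes its values in K. *)

Definition derivableC (K : realType) (f : K -> K[i]) (x : K) : Prop :=
  derivable (fun t => complex.Re (f t)) x 1 /\
  derivable (fun t => complex.Im (f t)) x 1.

(* As for derive1, the value is a default one where f is not derivable. *)
Definition derive1C (K : realType) (f : K -> K[i]) (x : K) : K[i] :=
  Complex (derive1 (fun t => complex.Re (f t)) x)
          (derive1 (fun t => complex.Im (f t)) x).

Definition integrableC (K : realType) (A : set K) (f : K -> K[i]) : Prop :=
  lebesgue_measure.-integrable A (fun x => (complex.Re (f x))%:E) /\
  lebesgue_measure.-integrable A (fun x => (complex.Im (f x))%:E).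

Definition integralC (K : realType) (A : set K) (f : K -> K[i]) : K[i] :=
  Complex (\int[lebesgue_measure]_(x in A) complex.Re (f x))
          (\int[lebesgue_measure]_(x in A) complex.Im (f x)).

(* e^{i theta} *)
Definition expi (K : realType) (theta : K) : K[i] :=
  Complex (cos theta) (sin theta).

Definition fourier (K : realType) (f : K -> K[i]) (x : K) : K[i] :=
  real_complex K (Num.sqrt (2 * pi))^-1 *
  integralC setT (fun t => f t * expi (- (x * t))).

Definition fourier_algebra (K : realType) : set (K -> K[i]) :=
  [set h | exists2 f : K -> K[i],
     integrableC setT f & forall x, h x = fourier f x].

Definition abs_continuousC (K : realType) (a b : K) (f : K -> K[i]) : Prop :=
  forall e : K, 0 < e -> exists2 d : K, 0 < d &
    forall (n : nat) (u v : 'I_n -> K),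
      (forall i, [/\ a <= u i, u i < v i & v i <= b]) ->
      trivIset setT (fun i => `]u i, v i[%classic) ->
      \sum_i (v i - u i) < d ->
      \sum_i normc (f (v i) - f (u i)) < e.

(* Analogues of variation and total_variation for complex values; the
   partition a < s_0 < ... < b is given by the sequence s of its points
   other than a. *)
Definition variationC (K : realType) (a b : K) (f : K -> K[i])
    (s : seq K) : K :=
  \sum_(0 <= n < size s)
    normc (f (nth b (a :: s) n.+1) - f (nth b (a :: s) n)).

Definition total_variationC (K : realType) (a b : K) (f : K -> K[i]) : \bar K :=
  ereal_sup [set (variationC a b f s)%:E | s in itv_partition a b].

(* Total variation on [a, +oo[ *)
Definition total_variationC_pinfty (K : realType) (a : K) (f : K -> K[i])
    : \bar K :=
  ereal_sup [set total_variationC a b f | b in `[a, +oo[%classic].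

(* Main.v *)
(** Absolute continuity makes [R] the integral of its derivative: cut off
    outside [0, a], each of Re R and Im R is a difference of two nondecreasing
    absolutely continuous functions, whose Stieltjes measures are dominated by
    the Lebesgue measure, so Radon-Nikodym provides a density, which Lebesgue's
    differentiation theorem identifies with the derivative.

    For a real component r of R, let G(t) be the integral over [0, +oo[ of
    r'(x) cos(xt); the function wanted is, up to a factor i, the odd function
    f(t) = sqrt(2/pi) G(t) / t.

    Integrability of G(t)/t. Let V(x) be the variation of r' on [x, +oo[, which
    dominates |r'(x)|. Shifting by the half period pi/t bounds the integral of
    r'(x) cos(xt) over [A, +oo[ by pi V(A) / t for A >= b. With A = b and (a)
    this settles large t. For small t it gives, whenever 1/2 <= tu <= 1,
      |G(t)| <= |r(u)| + u^-1 int_0^u x |r'(x)| dx + 2 pi u V(u),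
    and averaging over these u turns the integral of |G(t)|/t into at most that
    of the right-hand side divided by u, where each term is integrable.

    Inversion, for x > 0. With the factor exp(-et), Fubini's theorem applies to
    the double integral of exp(-et) sin(xt)/t r'(y) cos(yt). Integrating in t
    first leaves r'(y) times (atan((x+y)/e) + atan((x-y)/e)) / 2, which is
    bounded and, as e tends to 0, converges to pi/2 for y < x and to 0 for
    y > x. By dominated convergence the integral of G(t)/t sin(xt) over
    ]0, +oo[ is pi/2 r(x). *)
Require Import Defs.
From HB Require Import structures.
From mathcomp Require Import all_boot all_order all_algebra.
From mathcomp Require Import all_classical all_reals all_analysis.
From mathcomp Require Import measurable_realfun ring lra.

Set Implicit Arguments.
Unset Strict Implicit.
Unset Printing Implicit Defensive.

Import Order.TTheory GRing.Theory Num.Theory.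
Import numFieldNormedType.Exports.

Local Open Scope classical_set_scope.
Local Open Scope ring_scope.

(** * Absolutely continuous functions as integrals *)

(** In the bound for small t, each term divided by u has its own source of integrability: condition
    3) for |r(u)|, Tonelli's theorem and condition 5) for the integral of x |r'(x)|, and the finite
    integral of V for the last one. The double integral of r'(y) cos(yt) sin(xt)/t does not converge
    absolutely in t, so Fubini's theorem cannot be applied to it as it stands. The exponential
    factor remedies this; as G(t)/t is already known to be integrable, removing the factor costs
    only a dominated convergence. Condition (b) bears on an extension of R', whereas R is the
    integral of its derivative where that exists. The two agree almost everywhere on ]0, +oo[, so
    the estimates are made for a version [rho] of r' that equals the component of the extension from
    b on. The variation used is that of the complex function, which majorizes the variation of
    either component, so one V serves both. The factor i comes from oddness: the Fourier integral of
    an odd function is -i times its sine integral. *)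

Section chains.
Variable K : realType.
Implicit Types (f : K -> K) (L : seq (K * K)) (lo hi u v : K).

(* A chain lists from left to right intervals [p.1, p.2] of [lo, hi] that do not
   overlap, possibly reduced to a point. Unlike indexed disjoint families, such
   lists are easily concatenated, cut at a point and mapped by a monotone
   function. *)
Fixpoint chain lo L hi : bool :=
  if L is p :: L' then [&& lo <= p.1, p.1 <= p.2 & chain p.2 L' hi]
  else lo <= hi.

Definition chain_len L := \sum_(p <- L) (p.2 - p.1).

Definition chain_var f L := \sum_(p <- L) `|f p.2 - f p.1|.

(** Stated on the whole line, with one [d] for chains of any extent. This suits functions that are
    constant outside a segment. *)
Definition abs_continuous f := forall e, 0 < e -> exists2 d, 0 < d &
  forall lo L hi, chain lo L hi -> chain_len L < d -> chain_var f L < e.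

Lemma chain_len_cons p L : chain_len (p :: L) = (p.2 - p.1) + chain_len L.
Proof. by rewrite /chain_len big_cons. Qed.

Lemma chain_var_cons f p L : chain_var f (p :: L) = `|f p.2 - f p.1| + chain_var f L.
Proof. by rewrite /chain_var big_cons. Qed.

Lemma chain_len_nil : chain_len [::] = 0. Proof. by rewrite /chain_len big_nil. Qed.

Lemma chain_var_nil f : chain_var f [::] = 0. Proof. by rewrite /chain_var big_nil. Qed.

Lemma chain_len_cat L1 L2 : chain_len (L1 ++ L2) = chain_len L1 + chain_len L2.
Proof. by rewrite /chain_len big_cat. Qed.

Lemma chain_var_cat f L1 L2 : chain_var f (L1 ++ L2) = chain_var f L1 + chain_var f L2.
Proof. by rewrite /chain_var big_cat. Qed.

Lemma chain_var_ge0 f L : 0 <= chain_var f L.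
Proof. exact: sumr_ge0. Qed.

Lemma chain_le lo L hi : chain lo L hi -> lo <= hi.
Proof.
elim: L lo => //= p L IH lo /and3P[lop p12 /IH]; lra.
Qed.

Lemma chainWl lo lo' L hi : lo' <= lo -> chain lo L hi -> chain lo' L hi.
Proof.
case: L => /= [|p L] lolo'; first exact: le_trans.
by move=> /and3P[lop -> ->]; rewrite (le_trans lolo' lop).
Qed.

Lemma chainWr lo L hi hi' : hi <= hi' -> chain lo L hi -> chain lo L hi'.
Proof.
move=> hihi'; elim: L lo => /= [lo|p L IH lo].
  by move/le_trans; apply.
by move=> /and3P[-> -> /IH].
Qed.

Lemma chain_cat lo L1 m L2 hi :
  chain lo L1 m -> chain m L2 hi -> chain lo (L1 ++ L2) hi.
Proof.
elim: L1 lo => /= [lo|p L1 IH lo]; first exact: chainWl.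
by move=> /and3P[-> -> /IH h] /h.
Qed.

Lemma chain_len_le lo L hi : chain lo L hi -> chain_len L <= hi - lo.
Proof.
elim: L lo => /= [|p L IH] lo; first by rewrite chain_len_nil; lra.
by move=> /and3P[lop p12 /IH]; rewrite chain_len_cons; lra.
Qed.

(** An interval that straddles [u] is cut in two; by the triangle inequality this can only increase
    the variation, hence an inequality. *)
Lemma chain_split f lo L hi u : chain lo L hi -> lo <= u -> u <= hi ->
  exists L1 L2, [/\ chain lo L1 u, chain u L2 hi &
    chain_var f L <= chain_var f L1 + chain_var f L2].
Proof.
elim: L lo => /= [|p L IH] lo.
  move=> lohi lou uhi; exists [::], [::]; split => //=.
  by rewrite chain_var_nil; lra.
move=> /and3P[lop p12 pL] lou uhi.
have [p2u|up2] := leP p.2 u.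
  have [L1 [L2 [pL1 uL2 L12]]] := IH _ pL p2u uhi.
  exists (p :: L1), L2; split => //=.
    by rewrite lop p12.
  by rewrite !chain_var_cons; lra.
have [up1|p1u] := leP u p.1.
  exists [::], (p :: L); split => //=.
    by rewrite up1 p12.
  by rewrite !chain_var_cons chain_var_nil; lra.
exists [:: (p.1, u)], ((u, p.2) :: L); split => /=.
- by rewrite lop (ltW p1u) lexx.
- by rewrite lexx (ltW up2).
- rewrite !chain_var_cons chain_var_nil /=.
  have := ler_distD (f u) (f p.2) (f p.1); lra.
Qed.

Lemma chain_map (h : K -> K) lo L hi : {homo h : x y / x <= y} ->
  chain lo L hi -> chain (h lo) [seq (h p.1, h p.2) | p <- L] (h hi).
Proof.
move=> hh; elim: L lo => /= [|p L IH] lo; first exact: hh.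
by move=> /and3P[/hh-> /hh-> /IH].
Qed.

Lemma chain_var_map (h : K -> K) f L :
  chain_var f [seq (h p.1, h p.2) | p <- L] = chain_var (f \o h) L.
Proof. by rewrite /chain_var big_map. Qed.

(** An interval that meets [q] is absorbed into the hull of the two, and the insertion goes on with
    that hull. The hull of two intervals that meet is no longer than the two together, so total
    length does not grow. *)
Fixpoint chain_insert (q : K * K) L : seq (K * K) :=
  if L is p :: L' then
    if q.2 < p.1 then q :: L
    else if p.2 < q.1 then p :: chain_insert q L'
    else chain_insert (Num.min q.1 p.1, Num.max q.2 p.2) L'
  else [:: q].

Lemma is_chain_insert q lo L hi : q.1 <= q.2 -> chain lo L hi ->
  chain (Num.min lo q.1) (chain_insert q L) (Num.max hi q.2).
Proof.
elim: L q lo => /= [|p L IH] q lo q12.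
  by move=> _; rewrite q12 ge_min lexx orbT le_max lexx orbT.
move=> /and3P[lop p12 pL].
have [q2p1|p1q2] := ltP q.2 p.1.
  rewrite /= ge_min lexx orbT q12 (ltW q2p1) p12/=.
  by apply: chainWr pL; rewrite le_max lexx.
have [p2q1|q1p2] := ltP p.2 q.1.
  rewrite /= ge_min lop p12/=.
  have := IH q _ q12 pL.
  by rewrite minElt p2q1.
have := IH (Num.min q.1 p.1, Num.max q.2 p.2) _ _ pL.
rewrite /=; set m := Num.min q.1 p.1; set M := Num.max q.2 p.2.
have mq1 : m <= q.1 by rewrite ge_min lexx.
have q2M : q.2 <= M by rewrite le_max lexx.
move=> /(_ (le_trans mq1 (le_trans q12 q2M))) h.
have M_hi : M <= Num.max hi q.2.
  by rewrite ge_max !le_max lexx orbT/= (chain_le pL).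
apply: chainWl (chainWr _ h).
  rewrite /m le_min; apply/andP; split.
    by rewrite ge_min (le_trans lop p12).
  by rewrite le_min !ge_min lexx orbT/= lop.
by rewrite ge_max M_hi andbT le_max lexx.
Qed.

Lemma chain_len_insert q lo L hi : q.1 <= q.2 -> chain lo L hi ->
  chain_len (chain_insert q L) <= (q.2 - q.1) + chain_len L.
Proof.
elim: L q lo => /= [|p L IH] q lo q12.
  by rewrite chain_len_cons.
move=> /and3P[lop p12 pL].
have [q2p1|p1q2] := ltP q.2 p.1; first by rewrite chain_len_cons.
have [p2q1|q1p2] := ltP p.2 q.1.
  by rewrite !chain_len_cons; have := IH q _ q12 pL; lra.
have := IH (Num.min q.1 p.1, Num.max q.2 p.2) _ _ pL.
rewrite chain_len_cons /=.
case: (leP q.1 p.1) => h1; case: (leP q.2 p.2) => h2; lra.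
Qed.

Lemma mem_chain_insert q L x : q.1 <= q.2 -> q.1 < x <= q.2 \/
   (exists2 p, p \in L & p.1 < x <= p.2) ->
  exists2 p, p \in chain_insert q L & p.1 < x <= p.2.
Proof.
elim: L q => /= [|p L IH] q q12.
  case=> [qx|[p]]; last by rewrite in_nil.
  by exists q => //; rewrite inE.
have [q2p1|p1q2] := ltP q.2 p.1.
  case=> [qx|[p' p'L p'x]]; first by exists q => //; rewrite inE eqxx.
  by exists p' => //; rewrite inE p'L orbT.
have [p2q1|q1p2] := ltP p.2 q.1.
  case=> [qx|[p' + p'x]].
    have [|p' p'L p'x] := IH q q12; first by left.
    by exists p' => //; rewrite inE p'L orbT.
  rewrite inE => /orP[/eqP p'p|p'L].
    by exists p; rewrite ?inE ?eqxx// -p'p.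
  have [|p'' p''L p''x] := IH q q12; first by right; exists p'.
  by exists p'' => //; rewrite inE p''L orbT.
move=> H; apply: IH => /=.
  by rewrite ge_min !le_max q12.
case: H => [/andP[qx xq]|[p' + p'x]].
  by left; rewrite gt_min qx le_max xq.
rewrite inE => /orP[/eqP p'p|p'L].
  by move: p'x; rewrite p'p => /andP[px xp]; left; rewrite gt_min px orbT le_max xp orbT.
by right; exists p'.
Qed.

(* This makes absolute continuity, which is about disjoint intervals,
   applicable to open covers of null sets. *)
Lemma chain_cover (s : seq (K * K)) : {in s, forall p, p.1 <= p.2} ->
  exists lo L hi, [/\ chain lo L hi, chain_len L <= chain_len s &
    forall x, (exists2 p, p \in s & p.1 < x <= p.2) ->
              exists2 p, p \in L & p.1 < x <= p.2].
Proof.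
elim: s => [_|q s IH qs].
  exists 0, [::], 0; split => //=.
have [|lo [L [hi [cL lenL covL]]]] := IH.
  by move=> p ps; apply: qs; rewrite inE ps orbT.
have q12 : q.1 <= q.2 by apply: qs; rewrite inE eqxx.
exists (Num.min lo q.1), (chain_insert q L), (Num.max hi q.2); split.
- exact: is_chain_insert.
- by rewrite chain_len_cons; have := chain_len_insert q12 cL; lra.
- move=> x [p + px]; rewrite inE => /orP[/eqP pq|pL].
    by apply: mem_chain_insert => //; left; rewrite -pq.
  apply: mem_chain_insert => //; right; apply: covL; exists p => //.
Qed.

Lemma chain_pairwise lo L hi : chain lo L hi ->
  pairwise (fun q q' : K * K => q.2 <= q'.1) L.
Proof.
elim: L lo => //= q L IH lo /and3P[_ _ qL]; rewrite (IH _ qL) andbT.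
move: (q.2) qL; elim: (L) => //= q' L' IHL x /and3P[xq' q'12 q'L']; rewrite xq' /=.
by apply: IHL; apply: chainWl q'L'; apply: le_trans xq' q'12.
Qed.

Lemma chain_ordered lo L hi : chain lo L hi -> {in L, forall q, q.1 <= q.2}.
Proof.
elim: L lo => //= q L IH lo /and3P[_ q12 qL] q'.
by rewrite inE => /orP[/eqP->//|]; exact: IH qL _.
Qed.

Lemma abs_continuous_continuous f : abs_continuous f -> continuous f.
Proof.
move=> acf x; apply/cvgrPdist_lt => e e0.
have [d d0 dP] := acf _ e0.
near=> y.
have xyd : `|x - y| < d by near: y; exact: cvgr_dist_lt.
have [xy|yx] := leP x y.
- have := dP x [:: (x, y)] y; rewrite /= chain_len_cons chain_len_nil chain_var_cons chain_var_nil/=.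
  rewrite !addr0 xy !lexx/= distrC => /(_ isT); apply.
  by move: xyd; rewrite ltr_norml => /andP[]; lra.
- have := dP y [:: (y, x)] x; rewrite /= chain_len_cons chain_len_nil chain_var_cons chain_var_nil/=.
  rewrite !addr0 (ltW yx) !lexx/= => /(_ isT); apply.
  by move: xyd; rewrite ltr_norml => /andP[]; lra.
Unshelve. all: by end_near. Qed.

Lemma abs_continuousD f g : abs_continuous f -> abs_continuous g -> abs_continuous (f \+ g).
Proof.
move=> acf acg e e0.
have e20 : 0 < e / 2 by lra.
have [d d0 dP] := acf _ e20; have [d' d'0 d'P] := acg _ e20.
exists (Num.min d d'); first by rewrite lt_min d0.
move=> lo L hi cL; rewrite lt_min => /andP[/(dP _ _ _ cL) h1 /(d'P _ _ _ cL) h2].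
apply: le_lt_trans (_ : chain_var f L + chain_var g L < _); last by lra.
rewrite /chain_var -big_split/=; apply: ler_sum => p _ /=.
by rewrite opprD addrACA; exact: ler_normD.
Qed.

End chains.

(** * Variation of an absolutely continuous function *)

Section variation.
Variables (K : realType) (f : K -> K) (a : K).
Hypotheses (a0 : 0 <= a) (acf : abs_continuous f).

(** The retraction of the line onto [0, a]; composing with it extends a function on [0, a] by
    constants. *)
Definition clamp (x : K) : K := Num.max 0 (Num.min x a).

(* f is constant on each side of [0, a]. *)
Hypothesis f_clamp : forall x, f (clamp x) = f x.

Lemma clamp_homo : {homo clamp : x y / x <= y}.
Proof.
move=> x y xy; rewrite /clamp ge_max !le_max lexx/=; apply/orP; right.
by rewrite le_min !ge_min xy lexx orbT.
Qed.

Lemma clamp_ge0 x : 0 <= clamp x. Proof. by rewrite le_max lexx. Qed.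

Lemma clamp_le x : clamp x <= a. Proof. by rewrite ge_max a0 ge_min lexx orbT. Qed.

(** With [d] given by absolute continuity for 1, a chain in an interval of length d/2 has variation
    below 1. Clamping moves any chain into [0, a] without changing its variation, and [0, a] is
    covered by boundedly many intervals of length d/2. *)
Lemma chain_var_bounded : exists B, forall lo L hi, chain lo L hi -> chain_var f L <= B.
Proof.
have [d d0 dP] := acf ltr01.
have H n : forall lo L hi, chain lo L hi -> hi <= lo + n%:R * (d / 2) ->
    chain_var f L <= n%:R.
  elim: n => [|n IH] lo L hi cL.
    rewrite mul0r addr0 => hilo.
    elim: L lo cL hilo => [|p L IHL] lo /= cL hilo; first by rewrite chain_var_nil.
    move: cL => /and3P[lop p12 pL].
    have p2hi := chain_le pL.
    rewrite chain_var_cons.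
    have -> : p.2 = p.1 by apply/eqP; rewrite eq_le p12 andbT; lra.
    by rewrite subrr normr0 add0r; apply: (IHL _ pL); lra.
  move=> hin.
  have [hilo|lohi] := leP hi (lo + d / 2).
    apply: ltW; apply: (@lt_le_trans _ _ 1); last by rewrite ler1n.
    apply: (dP _ _ _ cL); have := chain_len_le cL; lra.
  have [||L1 [L2 [c1 c2 c12]]] := @chain_split _ f _ _ _ (lo + d / 2) cL.
  - lra.
  - lra.
  have h2 := IH _ _ _ c2; have h1 : chain_var f L1 < 1.
    by apply: (dP _ _ _ c1); have := chain_len_le c1; lra.
  rewrite -natr1 in hin *.
  have : hi <= lo + d / 2 + n%:R * (d / 2) by lra.
  move/h2; lra.
pose n := Num.bound (a / (d / 2)).
exists n%:R => lo L hi cL.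
rewrite (_ : chain_var f L = chain_var f [seq (clamp p.1, clamp p.2) | p <- L]); last first.
  by rewrite chain_var_map /chain_var; apply: eq_bigr => p _ /=; rewrite !f_clamp.
apply: (H n _ _ _ (chain_map clamp_homo cL)).
have h := clamp_le hi; have h' := clamp_ge0 lo.
have : a / (d / 2) <= n%:R.
  by apply: ltW; apply: archi_boundP; rewrite divr_ge0 ?divr_ge0 ?(ltW d0).
rewrite ler_pdivrMr; last lra.
lra.
Qed.

(** The left end of the chain is free, so [varf x] is the variation on ]-oo, x], which
    [chain_var_bounded] makes finite. *)
Definition chain_vars x := [set chain_var f L | L in [set L | exists lo, chain lo L x]].

Definition varf x : K := sup (chain_vars x).

Lemma has_sup_chain_vars x : has_sup (chain_vars x).
Proof.
split.
  by exists (chain_var f [::]), [::] => //; exists x => /=.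
have [B BP] := chain_var_bounded; exists B => _ [L [lo cL] <-]; exact: BP cL.
Qed.

Lemma chain_var_le_varf lo L x : chain lo L x -> chain_var f L <= varf x.
Proof.
move=> cL; apply: ub_le_sup; first by have [] := has_sup_chain_vars x.
by exists L => //; exists lo.
Qed.

Lemma varf_bounded : exists B, forall x, 0 <= varf x <= B.
Proof.
have [B BP] := chain_var_bounded; exists B => x; apply/andP; split.
  rewrite (le_trans (chain_var_ge0 f [::]))//.
  by apply: (@chain_var_le_varf x) => /=.
apply: ge_sup; first by have [] := has_sup_chain_vars x.
by move=> _ [L [lo cL] <-]; exact: BP cL.
Qed.

Lemma varf_adherent x e : 0 < e ->
  exists lo L, chain lo L x /\ varf x - e < chain_var f L.
Proof.
move=> e0; have [_ [L [lo cL] <-] h] := sup_adherent e0 (has_sup_chain_vars x).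
by exists lo, L.
Qed.

Lemma varf_ge u v : u <= v -> `|f v - f u| <= varf v - varf u.
Proof.
move=> uv; rewrite lerBrDl; apply/ler_addgt0Pr => e e0.
have [lo [L [cL h]]] := varf_adherent u e0.
have : chain lo (L ++ [:: (u, v)]) v.
  by apply: chain_cat cL _ => /=; rewrite !lexx uv.
move/chain_var_le_varf; rewrite chain_var_cat chain_var_cons chain_var_nil /=; lra.
Qed.

Lemma varf_homo : {homo varf : x y / x <= y}.
Proof. by move=> x y /varf_ge; have := normr_ge0 (f y - f x); lra. Qed.

(** A chain that almost realizes [varf v] is cut at [u]. Its left part contributes at most [varf u],
    so the right part accounts for the increment. *)
Lemma varf_approx u v e : u <= v -> 0 < e ->
  exists2 M, chain u M v & varf v - varf u <= chain_var f M + e.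
Proof.
move=> uv e0; have [lo [L [cL h]]] := varf_adherent v e0.
have [lou|ulo] := leP lo u.
  have [L1 [L2 [c1 c2 c12]]] := @chain_split _ f _ _ _ u cL lou uv.
  by exists L2 => //; have := chain_var_le_varf c1; lra.
exists L; first by apply: chainWl cL; exact: ltW.
have : 0 <= varf u by have [B /(_ u)/andP[]] := varf_bounded.
lra.
Qed.

(** Each interval of the chain is replaced by a chain inside it that almost realizes the increment
    of [varf]. The total length does not increase, so the absolute continuity of [f] applies to the
    refined chain. *)
Lemma abs_continuous_varf : abs_continuous varf.
Proof.
move=> e e0.
have e20 : 0 < e / 2 by lra.
have [d d0 dP] := acf e20; exists d => // lo L hi cL lenL.
(* Half of [e] goes to the variation of [f], the other half is shared among the intervals of [L];
   the successor keeps the denominator nonzero when [L] is empty. *)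
suff [L' [cL' lenL' varL']] : exists L', [/\ chain lo L' hi, chain_len L' <= chain_len L &
    chain_var varf L <= chain_var f L' + (size L)%:R * (e / (2 * (size L).+1%:R))].
  have h1 : chain_var f L' < e / 2 by apply: (dP _ _ _ cL'); lra.
  apply: (le_lt_trans varL').
  rewrite [ltRHS](splitr e); apply: ltr_leD => //.
  rewrite mulrA ler_pdivrMr ?mulr_gt0// mulrA divfK// mulrC ler_pM2l//.
  by rewrite ler_nat.
set eta := e / (2 * (size L).+1%:R).
have eta0 : 0 < eta by rewrite divr_gt0// mulr_gt0.
(* [eta] depends on the size of [L] and must be fixed before the induction on [L]. *)
move: eta eta0 => eta eta0 {lenL}.
elim: L lo cL => [|p L IH] lo /= cL.
  by exists [::]; split => //=; rewrite !chain_var_nil mul0r addr0.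
move: cL => /and3P[lop p12 /IH[L' [cL' lenL' varL']]].
have [M cM hM] := varf_approx p12 eta0.
exists (M ++ L'); split.
- apply: chain_cat cL'; exact: chainWl cM.
- by rewrite chain_len_cat chain_len_cons; have := chain_len_le cM; lra.
- rewrite chain_var_cat chain_var_cons -natr1 ger0_norm ?subr_ge0 ?varf_homo//; lra.
Qed.

End variation.

(** * Stieltjes measures and their densities *)

Section density.
Variable K : realType.
Local Notation mu := (@lebesgue_measure K).

Lemma lebesgue_stieltjes_itvoc (F : cumulative K K) (u v : K) : u <= v ->
  lebesgue_stieltjes_measure F `]u, v] = (F v - F u)%:E.
Proof.
move=> uv; rewrite /lebesgue_stieltjes_measure /measure_extension/=.
by rewrite measurable_mu_extE/= ?wlength_itv_bnd//; exact: is_ocitv.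
Qed.

Lemma lebesgue_stieltjes_setT_lty (F : cumulative K K) (B : K) :
  (forall x, `|F x| <= B) -> (lebesgue_stieltjes_measure F setT < +oo)%E.
Proof.
move=> FB; rewrite -(bigcup_itvT false false).
pose I n : set K := `]- (n%:R), n%:R]%classic.
have : (lebesgue_stieltjes_measure F \o I) n @[n --> \oo] -->
    lebesgue_stieltjes_measure F (\bigcup_n I n).
  apply: nondecreasing_cvg_mu; rewrite /I//; first exact: bigcup_measurable.
  by move=> *; apply/subsetPset/subset_itv; rewrite leBSide/= ?lerN2 ler_nat.
move=> cI; apply: (@le_lt_trans _ _ (B + B)%:E); last exact: ltry.
rewrite -(cvg_lim _ cI)//; apply: lime_le; first by apply/cvg_ex; eexists; exact: cI.
apply: nearW => n /=; rewrite lebesgue_stieltjes_itvoc ?ge0_cp//.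
rewrite lee_fin; have := FB n%:R; have := FB (- n%:R).
by rewrite !ler_norml; lra.
Qed.

(** A null set is covered by open intervals of total length below [d]. Finitely many of them merge
    into a chain that is no longer, on which [F] varies by less than [e]; continuity from below
    extends this bound to the whole cover. *)
Lemma lebesgue_stieltjes_dominated (F : cumulative K K) : abs_continuous F ->
  lebesgue_stieltjes_measure F `<< mu.
Proof.
move=> acF; apply/null_content_dominatesP => A mA A0.
apply/eqP; rewrite eq_le measure_ge0 andbT.
apply/lee_addgt0Pr => e e0; rewrite add0e.
have [d d0 dP] := acF _ e0.
have A0' : (wlength (@idfun K))^*%mu A = 0 :> \bar K by exact: A0.
have [I [cI AI] Id] : exists2 I, open_itv_cover A I &
    (\sum_(k <oo) wlength (@idfun K) (I k) < d%:E)%E.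
  have : (ereal_inf [set \sum_(k <oo) wlength (@idfun K) (I k) | I in open_itv_cover A]
         < d%:E)%E.
    by rewrite -outer_measure_open_itv_cover A0' lte_fin.
  by move=> /ereal_inf_lt[_ [I AI <-]] Id; exists I.
have [ab abI] := choice cI.
(* A covering interval may be empty, with its endpoints in reversed order. Such pairs are dropped,
   since [chain_cover] requires ordered ones. *)
pose s n := [seq ((ab k).1, (ab k).2) | k <- iota 0 n & (ab k).1 <= (ab k).2].
have sum_s n : chain_len (s n) < d.
  rewrite -lte_fin; apply: le_lt_trans Id.
  have -> : (chain_len (s n))%:E = (\sum_(0 <= k < n) wlength (@idfun K) (I k))%E.
    rewrite /chain_len /s big_map big_filter /index_iota subn0 -sumEFin.
    rewrite [LHS]big_mkcond; apply: eq_bigr => k _ /=.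
    rewrite abI wlength_itv/= lte_fin.
    by case: ltgtP => //= ->; rewrite subrr.
  apply: nneseries_lim_ge => k _ _.
  by rewrite wlength_ge0//.
pose U n := \bigcup_(k < n) I k.
have mI k : measurable (I k) by rewrite abI.
have mU n : measurable (U n) by exact: bigcup_measurable.
have mUU : measurable (\bigcup_n U n) by exact: bigcup_measurable.
have cU : lebesgue_stieltjes_measure F (U n) @[n --> \oo] -->
    lebesgue_stieltjes_measure F (\bigcup_n U n).
  apply: nondecreasing_cvg_mu => //.
  move=> m n mn; apply/subsetPset => x [k km Ikx]; exists k => //=.
  exact: leq_trans mn.
apply: (@le_trans _ _ (lebesgue_stieltjes_measure F (\bigcup_n U n))).
  apply: le_measure; rewrite ?inE//.
  by move=> x /AI[k _ Ikx]; exists k.+1 => //; exists k => /=.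
rewrite -(cvg_lim _ cU)//; apply: lime_le; first by apply/cvg_ex; eexists; exact: cU.
apply: nearW => n.
have [|lo [L [hi [cL lenL covL]]]] := @chain_cover _ (s n).
  by move=> p /mapP[k]; rewrite mem_filter => /andP[h _] ->.
pose W : set K := \big[setU/set0]_(p <- L) `]p.1, p.2]%classic.
have mW (L' : seq (K * K)) :
    measurable (\big[setU/set0]_(p <- L') `]p.1, p.2]%classic : set K).
  elim: L' => [|p L' IH]; first by rewrite big_nil.
  by rewrite big_cons; apply: measurableU.
apply: (@le_trans _ _ (lebesgue_stieltjes_measure F W)).
  apply: le_measure; rewrite ?inE//.
  - exact: mU.
  - exact: mW.
  move=> x [k /= kn]; rewrite abI /= in_itv/= => /andP[h1 h2].
  have [|p pL px] := covL x.
    exists (ab k).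
      rewrite /s; apply/mapP; exists k; last by rewrite -surjective_pairing.
      by rewrite mem_filter mem_iota /= add0n kn andbT; apply: ltW; apply: lt_trans h2.
    by rewrite h1 ltW.
  by rewrite /W -bigcup_seq; exists p.
apply: (@le_trans _ _ (\sum_(p <- L) lebesgue_stieltjes_measure F `]p.1, p.2]%classic)%E).
  rewrite /W; elim: (L) => [|p L' IH]; first by rewrite !big_nil measure0.
  rewrite !big_cons; apply: (le_trans (measureU2 _ _ _)) => //.
    exact: mW.
  by rewrite leeD2l.
have := dP _ _ _ cL (le_lt_trans lenL (sum_s n)).
move=> /ltW; rewrite -lee_fin; apply: le_trans.
rewrite /chain_var -sumEFin.
elim: L lo cL {lenL covL W} => [|p L IH] lo /=; first by rewrite !big_nil.
move=> /and3P[_ p12 /IH]; rewrite !big_cons => h.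
rewrite lebesgue_stieltjes_itvoc//; apply: leeD => //.
by rewrite lee_fin ler_norm.
Qed.

(** Boundedness of [F] makes its Stieltjes measure finite, and hence the density integrable on the
    whole line. *)
Lemma nondecreasing_density (F : K -> K) (B : K) : {homo F : x y / x <= y} ->
  (forall x, `|F x| <= B) -> abs_continuous F ->
  exists2 w : K -> K, mu.-integrable setT (EFin \o w) &
    forall u v, u <= v -> F v - F u = \int[mu]_(x in `]u, v]) w x.
Proof.
move=> ndF FB acF.
pose mixin := isCumulative.Build _ _ _ F ndF (right_continuousW (abs_continuous_continuous acF)).
pose cF : cumulative K K := HB.pack F mixin.
have nuoo := @lebesgue_stieltjes_setT_lty cF B FB.
pose nu0 : {measure set _ -> \bar K} := lebesgue_stieltjes_measure cF.
have nufin : fin_num_fun nu0.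
  by apply: lty_fin_num_fun.
pose nu : {finite_measure set _ -> \bar K} :=
  HB.pack (nu0 : set _ -> \bar K) (Measure.class nu0)
    (Measure_isFinite.Build _ _ _ (nu0 : set _ -> _) nufin).
have [w [w0 wfin intw wE]] := @radon_nikodym_sigma_finite _ _ _ mu nu
  (@lebesgue_stieltjes_dominated cF acF).
have wfine x : (fine (w x))%:E = w x by rewrite fineK.
exists (fine \o w).
  by apply: eq_integrable intw => // x _ /=; rewrite wfine.
move=> u v uv; rewrite /Rintegral.
under eq_integral do rewrite wfine.
rewrite -wE// /nu/= (@lebesgue_stieltjes_itvoc cF)//.
Qed.

End density.

(** * Derivative almost everywhere of an absolutely continuous function *)

Section abs_continuous_ftc.
Variable K : realType.
Local Notation mu := (@lebesgue_measure K).

(* f = (varf f + f) - varf f is a difference of nondecreasing functions. *)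
Lemma abs_continuous_integral (f : K -> K) (a : K) : 0 <= a -> abs_continuous f ->
  (forall x, f (clamp a x) = f x) ->
  exists2 w : K -> K, mu.-integrable setT (EFin \o w) &
    forall u v, u <= v -> f v - f u = \int[mu]_(x in `]u, v]) w x.
Proof.
move=> a0 acf fc.
have [B TB] := varf_bounded a0 acf fc.
have Tnd := varf_homo a0 acf fc.
have acT := abs_continuous_varf a0 acf fc.
have [fB fBP] : exists B', forall x, `|f x| <= B'.
  exists (`|f 0| + B) => x; rewrite -fc.
  have := varf_ge a0 acf fc (clamp_ge0 a x).
  have := TB 0; have := TB (clamp a x) => /andP[_ h1] /andP[h2 _] h3.
  have := ler_normD (f 0) (f (clamp a x) - f 0); rewrite addrC subrK; lra.
have [wT iT wTE] : exists2 w : K -> K, mu.-integrable setT (EFin \o w) &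
    forall u v, u <= v -> varf f v - varf f u = \int[mu]_(x in `]u, v]) w x.
  apply: (@nondecreasing_density _ _ B) => // x.
  by have /andP[h1 h2] := TB x; rewrite ger0_norm.
have [wS iS wSE] : exists2 w : K -> K, mu.-integrable setT (EFin \o w) &
    forall u v, u <= v -> (varf f \+ f) v - (varf f \+ f) u = \int[mu]_(x in `]u, v]) w x.
  apply: (@nondecreasing_density _ _ (B + fB)).
  - move=> x y xy /=; have := varf_ge a0 acf fc xy.
    by rewrite ler_norml => /andP[]; lra.
  - move=> x /=; have := TB x => /andP[h1 h2].
    by rewrite (le_trans (ler_normD _ _))// lerD// ger0_norm.
  - exact: abs_continuousD.
exists (wS \- wT).
  rewrite (_ : _ \o _ = (EFin \o wS) \- (EFin \o wT))%E//.
  exact: integrableB.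
move=> u v uv; rewrite RintegralB//; last 2 first.
- exact: integrableS iS.
- exact: integrableS iT.
by rewrite -wTE// -wSE//=; lra.
Qed.

Lemma ae_derivable_indefinite (f w : K -> K) : mu.-integrable setT (EFin \o w) ->
  (forall u v, u <= v -> f v - f u = \int[mu]_(x in `]u, v]) w x) ->
  {ae mu, forall x, derivable f x 1 /\ derive1 f x = w x}.
Proof.
move=> iw fw.
(* Differentiation under this form applies to integrals from -oo; [f] has the same increments as [F]
   and differs from it by a constant. *)
pose F x := \int[mu]_(t in `]-oo, x]) w t.
have fE : f = F \+ cst (f 0 - F 0).
  apply/funext => x /=.
  have H u v : u <= v -> f v - f u = F v - F u.
    move=> uv; rewrite fw// /F Rintegral_itvB//; first exact: integrableS iw.
  have [x0|x0] := leP 0 x.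
    by have := H _ _ x0; lra.
  by have := H _ _ (ltW x0); lra.
have locw : locally_integrable setT w.
  by apply: open_integrable_locally => //; exact: openT.
have iwy y : mu.-integrable `]-oo, y] (EFin \o w) by exact: integrableS iw.
have := FTC1Ny iwy locw.
apply: filterS; first exact: (ae_filter_ringOfSetsType mu).
move=> x /= [dF FE].
have dc : derivable (cst (f 0 - F 0) : K -> K) x 1 by exact: derivable_cst.
rewrite fE; split; first exact: (derivableD dF dc).
by rewrite derive1E (deriveD dF dc) derive_cst addr0 -derive1E.
Qed.

End abs_continuous_ftc.

(** * Real-valued Lebesgue integrals *)

Section integral_complements.
Variable K : realType.
Local Notation mu := (@lebesgue_measure K).

Lemma integrable_le (D : set K) (f g : K -> K) : measurable D ->
  measurable_fun D f -> mu.-integrable D (EFin \o g) ->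
  (forall x, D x -> `|f x| <= g x) -> mu.-integrable D (EFin \o f).
Proof.
move=> mD mf ig fg; apply: le_integrable ig => //; first exact/measurable_EFinP.
by move=> x Dx; rewrite /= lee_fin (le_trans (fg x Dx))// ler_norm.
Qed.

Lemma normr_Rintegral_le (D : set K) (f g : K -> K) : measurable D ->
  measurable_fun D f -> mu.-integrable D (EFin \o g) ->
  (forall x, D x -> `|f x| <= g x) ->
  `|\int[mu]_(x in D) f x| <= \int[mu]_(x in D) g x.
Proof.
move=> mD mf ig fg; have if_ := integrable_le mD mf ig fg.
apply: (le_trans (@le_normr_Rintegral _ _ _ mu _ _ mD if_)).
apply: le_Rintegral => //; exact: integrable_norm.
Qed.

Lemma integrable_add (D : set K) (f g : K -> K) : measurable D ->
  mu.-integrable D (EFin \o f) -> mu.-integrable D (EFin \o g) ->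
  mu.-integrable D (EFin \o (fun x => f x + g x)).
Proof. by move=> mD if_ ig; exact: integrableD if_ ig. Qed.

Lemma integrable_mull (D : set K) (c : K) (f : K -> K) : measurable D ->
  mu.-integrable D (EFin \o f) -> mu.-integrable D (EFin \o (fun x => c * f x)).
Proof. by move=> mD if_; exact: integrableZl if_. Qed.

Lemma integrable_bounded (D : set K) (f : K -> K) (M : K) : measurable D ->
  (mu D < +oo)%E -> measurable_fun D f -> (forall x, D x -> `|f x| <= M) ->
  mu.-integrable D (EFin \o f).
Proof.
move=> mD muD mf fM; apply: measurable_bounded_integrable => //.
by exists M; split; [exact: num_real|move=> x Mx y /fM /le_trans; apply; exact: ltW].
Qed.

Lemma lebesgue_measure_itv_lty (b0 b1 : bool) (x y : K) :
  (mu [set` Interval (BSide b0 x) (BSide b1 y)] < +oo)%E.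
Proof. by rewrite lebesgue_measure_itv/=; case: ifP => // _; rewrite -EFinD ltry. Qed.

Lemma integrable_setU (D1 D2 : set K) (f : K -> K) : measurable D1 -> measurable D2 ->
  mu.-integrable D1 (EFin \o f) -> mu.-integrable D2 (EFin \o f) ->
  mu.-integrable (D1 `|` D2) (EFin \o f).
Proof.
move=> mD1 mD2 /integrableP[m1 i1] /integrableP[m2 i2].
have mU : measurable_fun (D1 `|` D2) (EFin \o f) by apply/measurable_funU.
apply/integrableP; split => //.
have UD : D1 `|` D2 = D1 `|` (D2 `\` D1) by rewrite setDE setUIr setUv setIT.
rewrite UD ge0_integral_setU//=.
- apply: lte_add_pinfty => //; apply: le_lt_trans i2.
  apply: ge0_subset_integral => //; first exact: measurableD.
  by apply/measurable_EFinP; apply: measurableT_comp => //; exact/measurable_EFinP.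
- have mD : measurable (D2 `\` D1) by exact: measurableD.
  exact: mD.
- by rewrite -UD; apply/measurable_EFinP; apply: measurableT_comp => //; exact/measurable_EFinP.
- by apply/disj_setPS => x [? []].
Qed.

Lemma integrable_setT_split (f : K -> K) :
  mu.-integrable `]-oo, 0[ (EFin \o f) -> mu.-integrable `]0, +oo[ (EFin \o f) ->
  mu.-integrable setT (EFin \o f).
Proof.
move=> ineg ipos.
have i0 : mu.-integrable `[0, 0] (EFin \o f).
  apply: (@integrable_bounded _ _ `|f 0|) => //.
  - exact: lebesgue_measure_itv_lty.
  - by rewrite set_itv1; exact: measurable_fun_set1.
  - by rewrite set_itv1 => x ->.
have -> : setT = `]-oo, 0[%classic `|` (`[0, 0]%classic `|` `]0, +oo[%classic) :> set K.
  apply/esym; rewrite -subTset => x _ /=; rewrite !in_itv/= andbT.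
  by case: (ltgtP x 0) => _; [left|right; right|right; left].
apply: integrable_setU => //; first exact: measurableU.
exact: integrable_setU.
Qed.

(** The pushforward agrees with Lebesgue measure on half-open intervals, and these determine it. *)
Lemma lebesgue_measure_shift (h : K) (A : set K) : measurable A ->
  pushforward mu (fun x : measurableTypeR K => x + h : measurableTypeR K) A = mu A.
Proof.
have mh : measurable_fun setT (fun x : measurableTypeR K => x + h : measurableTypeR K).
  by apply: measurable_funD.
pose mixin := isMeasurableFun.Build _ _ _ _ _ mh.
pose phi : {mfun _ >-> _} := HB.pack (fun x : measurableTypeR K => x + h : measurableTypeR K) mixin.
move=> mA; apply/esym; rewrite -[LHS]/(lebesgue_measure A).
apply: (@lebesgue_measure_unique _ (pushforward mu phi)) => //= _ [[a b]] _ <-.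
rewrite /pushforward.
rewrite (_ : _ @^-1` _ = `]a - h, b - h]%classic); last first.
  by apply/seteqP; split => x /=; rewrite !in_itv/= ltrBlDr lerBrDr.
rewrite !lebesgue_measure_itv/= !lte_fin ltrD2r; case: ifP => // _.
by rewrite -!EFinD; congr EFin; ring.
Qed.

Section measure_preserving.
Variable phi : measurableTypeR K -> measurableTypeR K.
Hypotheses (mphi : measurable_fun setT phi)
  (mu_phi : forall A : set K, measurable A -> pushforward mu phi A = mu A).
Variables (D : set K) (f : K -> K).
Hypotheses (mD : measurable D) (mf : measurable_fun setT f)
  (iDf : mu.-integrable D (EFin \o f)).

Lemma integrable_measure_preserving :
  mu.-integrable (phi @^-1` D) (EFin \o (fun x => f (phi x))).
Proof.
move: iDf => /integrableP[_ fD]; apply/integrableP; split.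
  apply/measurable_EFinP; apply: measurable_funTS.
  by apply: measurableT_comp mf _; exact: mphi.
apply: le_lt_trans fD.
rewrite (_ : (\int[mu]_(x in D) _)%E =
   (\int[pushforward mu phi]_(x in D) `|(EFin \o f) x|)%E).
  rewrite (ge0_integral_pushforward mphi)//.
  by apply: measurable_funTS; apply: measurableT_comp => //; exact/measurable_EFinP.
by apply: eq_measure_integral => A mA _; exact/esym/mu_phi.
Qed.

Lemma Rintegral_measure_preserving :
  \int[mu]_(x in phi @^-1` D) f (phi x) = \int[mu]_(x in D) f x.
Proof.
congr fine.
rewrite -[LHS](integral_pushforward mphi (f := EFin \o f))//.
- by apply: eq_measure_integral => A mA _; exact: mu_phi.
- exact/measurable_EFinP.
- exact: integrable_measure_preserving.
Qed.

End measure_preserving.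

Section shift.
Variables (h : K) (D : set K) (f : K -> K).
Hypotheses (mD : measurable D) (mf : measurable_fun setT f)
  (iDf : mu.-integrable D (EFin \o f)).
Let phi : measurableTypeR K -> measurableTypeR K := fun x => x + h.
Let mphi : measurable_fun setT phi.
Proof. exact: measurable_funD. Qed.

Lemma integrable_shift :
  mu.-integrable ((+%R^~ h) @^-1` D) (EFin \o (fun x => f (x + h))).
Proof.
by apply: (integrable_measure_preserving mphi) => // A; exact: lebesgue_measure_shift.
Qed.

Lemma Rintegral_shift :
  \int[mu]_(x in (+%R^~ h) @^-1` D) f (x + h) = \int[mu]_(x in D) f x.
Proof.
by apply: (Rintegral_measure_preserving mphi) => // A; exact: lebesgue_measure_shift.
Qed.

End shift.

Section reflection.
Variables (D : set K) (f : K -> K).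
Hypotheses (mD : measurable D) (mf : measurable_fun setT f)
  (iDf : mu.-integrable D (EFin \o f)).
Let phi : measurableTypeR K -> measurableTypeR K := -%R.
Let mphi : measurable_fun setT phi.
Proof. exact: measurable_funN. Qed.

Lemma integrable_reflection :
  mu.-integrable (-%R @^-1` D) (EFin \o (fun x => f (- x))).
Proof.
by apply: (integrable_measure_preserving mphi) => // A; exact: lebesgue_measureN.
Qed.

Lemma Rintegral_reflection :
  \int[mu]_(x in -%R @^-1` D) f (- x) = \int[mu]_(x in D) f x.
Proof.
by apply: (Rintegral_measure_preserving mphi) => // A; exact: lebesgue_measureN.
Qed.

End reflection.

End integral_complements.

(** * Tonelli and Fubini on a product of two sets *)

Section fubini_real.
Variable K : realType.
Local Notation mu := (@lebesgue_measure K).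
Local Notation T := (measurableTypeR K).
Variables (D1 D2 : set K) (f : K -> K -> K).
Hypotheses (mD1 : measurable D1) (mD2 : measurable D2)
  (mf : measurable_fun setT (fun z : T * T => f z.1 z.2)).

(** The indicators turn integrals over [D1] and [D2] into integrals over the whole line, to which
    the theorems for a product of measures apply. *)
Let F (z : T * T) : \bar K := (\1_D1 z.1 * \1_D2 z.2 * f z.1 z.2)%:E.

Let mF : measurable_fun setT F.
Proof.
apply/measurable_EFinP; apply: measurable_funM => //; apply: measurable_funM.
- by apply: measurableT_comp => //; exact: measurable_indic.
- by apply: measurableT_comp => //; exact: measurable_indic.
Qed.

Let int12E : (\int[mu]_(x in D1) \int[mu]_(y in D2) (f x y)%:E =
  \int[mu]_x \int[mu]_y F (x, y))%E.
Proof.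
rewrite integral_mkcond; apply: eq_integral => x _; rewrite patchE.
rewrite /F /=; case: ifPn => xD1.
  rewrite integral_mkcond; apply: eq_integral => y _; rewrite patchE.
  rewrite !indicE xD1 mul1r; case: ifPn => yD2; first by rewrite mul1r.
  by rewrite mul0r.
by under eq_integral do rewrite indicE (negbTE xD1) !mul0r; rewrite integral0.
Qed.

Let int21E : (\int[mu]_(y in D2) \int[mu]_(x in D1) (f x y)%:E =
  \int[mu]_y \int[mu]_x F (x, y))%E.
Proof.
rewrite integral_mkcond; apply: eq_integral => y _; rewrite patchE.
rewrite /F /=; case: ifPn => yD2.
  rewrite integral_mkcond; apply: eq_integral => x _; rewrite patchE.
  rewrite !indicE yD2 mulr1; case: ifPn => xD1; first by rewrite mul1r.
  by rewrite mul0r.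
by under eq_integral do rewrite !indicE (negbTE yD2) mulr0 mul0r; rewrite integral0.
Qed.

Hypothesis f0 : forall x y, D1 x -> D2 y -> 0 <= f x y.

Let F0 z : (0 <= F z)%E.
Proof.
rewrite /F lee_fin !indicE.
case: (boolP (z.1 \in D1)) => xD1; last by rewrite !mul0r.
case: (boolP (z.2 \in D2)) => yD2; last by rewrite mulr0 mul0r.
by rewrite !mul1r; apply: f0; exact: set_mem.
Qed.

Lemma measurable_integral1 :
  measurable_fun D1 (fun x => \int[mu]_(y in D2) (f x y)%:E)%E.
Proof.
apply: (@eq_measurable_fun _ _ _ _ _ (fun x => \int[mu]_y F (x, y))%E).
  move=> x xD1; rewrite [RHS]integral_mkcond; apply: eq_integral => y _.
  rewrite patchE /F /= !indicE xD1 mul1r.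
  by case: ifPn => _; rewrite ?mul1r ?mul0r.
by apply: measurable_funTS; exact: (measurable_fun_fubini_tonelli_F F).
Qed.

Lemma measurable_integral2 :
  measurable_fun D2 (fun y => \int[mu]_(x in D1) (f x y)%:E)%E.
Proof.
apply: (@eq_measurable_fun _ _ _ _ _ (fun y => \int[mu]_x F (x, y))%E).
  move=> y yD2; rewrite [RHS]integral_mkcond; apply: eq_integral => x _.
  rewrite patchE /F /= !indicE yD2 mulr1.
  by case: ifPn => _; rewrite ?mul1r ?mul0r.
by apply: measurable_funTS; exact: (measurable_fun_fubini_tonelli_G F).
Qed.

Lemma tonelli_real :
  (\int[mu]_(x in D1) \int[mu]_(y in D2) (f x y)%:E =
   \int[mu]_(y in D2) \int[mu]_(x in D1) (f x y)%:E)%E.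
Proof. by rewrite int12E int21E; exact: fubini_tonelli. Qed.

Variables (g1 g2 : K -> K).
Hypotheses (ig1 : mu.-integrable D1 (EFin \o g1)) (ig2 : mu.-integrable D2 (EFin \o g2))
  (fg : forall x y, D1 x -> D2 y -> `|f x y| <= g1 x * g2 y).

Let N2 := (\int[mu]_(x in D2) `|(EFin \o g2) x|)%E.

Let int_norm_lty : (\int[mu]_(x in D1) (`|(EFin \o g1) x| * N2) < +oo)%E.
Proof.
have mg1 : measurable_fun D1 (abse \o (EFin \o g1)).
  by have /integrableP[mg1 _] := ig1; exact: measurableT_comp.
rewrite (_ : N2 = (fine N2)%:E); last first.
  by apply/esym/fineK; rewrite ge0_fin_numE; [have /integrableP[] := ig2|exact: integral_ge0].
rewrite (ge0_integralZr mu mD1 mg1 (fun x _ => abse_ge0 _)); last first.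
  rewrite lee_fin; apply: fine_ge0; exact: integral_ge0.
apply: lte_mul_pinfty; last exact: ltry.
- by apply: integral_ge0 => x _; exact: abse_ge0.
- have /integrableP[_ N1oo] := ig1.
  by rewrite ge0_fin_numE; [exact: N1oo|apply: integral_ge0 => x _; exact: abse_ge0].
Qed.

Let iF : (mu \x mu)%E.-integrable setT F.
Proof.
have mg1 : measurable_fun D1 (abse \o (EFin \o g1)).
  by have /integrableP[mg1 _] := ig1; exact: measurableT_comp.
have mg2 : measurable_fun D2 (abse \o (EFin \o g2)).
  by have /integrableP[mg2 _] := ig2; exact: measurableT_comp.
apply/(integrable12ltyP mu mu mF).
apply: le_lt_trans int_norm_lty.
rewrite [leRHS]integral_mkcond; apply: (ge0_le_integral mu measurableT).
- by move=> x _; exact: integral_ge0.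
- apply: (measurable_fun_fubini_tonelli_F (abse \o F)) => [|z].
    by apply: measurableT_comp mF; exact: abse_measurable.
  exact: (abse_ge0 (F z)).
- apply/(measurable_restrictT _ _).1; first exact: mD1.
  apply: emeasurable_funM.
    exact: mg1.
  exact: measurable_cst.
move=> x _; rewrite patchE /F; case: ifPn => [/set_mem xD1|xD1]; last first.
  by under eq_integral do rewrite indicE (negbTE xD1) !mul0r abse0; rewrite integral0.
rewrite /N2 -(ge0_integralZl mu mD2 mg2 (fun y _ => abse_ge0 _) (abse_ge0 _)).
rewrite [leRHS]integral_mkcond; apply: (ge0_le_integral mu measurableT).
- by move=> y _; exact: abse_ge0.
- apply: measurableT_comp; first exact: abse_measurable.
  by apply: measurableT_comp mF _; exact: pair1_measurable.
- apply/(measurable_restrictT _ _).1; first exact: mD2.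
  apply: emeasurable_funM.
    exact: measurable_cst.
  exact: mg2.
move=> y _; rewrite patchE /= !indicE (mem_set xD1) mul1r.
case: ifPn => [/set_mem yD2|yD2]; last by rewrite mul0r normr0.
rewrite mul1r lee_fin; apply: (le_trans (fg xD1 yD2)).
by apply: (le_trans (ler_norm _)); rewrite normrM.
Qed.

Lemma Rfubini : \int[mu]_(x in D1) \int[mu]_(y in D2) f x y =
   \int[mu]_(y in D2) \int[mu]_(x in D1) f x y.
Proof.
have mf1 x : measurable_fun setT (f x).
  by have := measurableT_comp mf (pair1_measurable (x : T)).
have mf2 y : measurable_fun setT (f ^~ y).
  by have := measurableT_comp mf (pair2_measurable (y : T)).
congr fine.
(* A real iterated integral takes [fine] of its inner integral; the separated bound makes every
   section integrable, so nothing is lost. *)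
transitivity (\int[mu]_(x in D1) \int[mu]_(y in D2) (f x y)%:E)%E.
  apply: eq_integral => x /set_mem xD1; apply: fineK.
  apply: integrable_fin_num; first exact: mD2.
  apply: (integrable_le mD2 (measurable_funTS (mf1 x)) _ (fun y => fg xD1)).
  exact: integrable_mull.
transitivity (\int[mu]_(y in D2) \int[mu]_(x in D1) (f x y)%:E)%E.
  by rewrite int12E int21E; exact: Fubini.
apply: eq_integral => y /set_mem yD2; apply/esym/fineK.
apply: integrable_fin_num; first exact: mD1.
apply: (integrable_le mD1 (measurable_funTS (mf2 y)) _ (fun x xD1 => fg xD1 yD2)).
rewrite (_ : _ \o _ = fun x => ((EFin \o g1) x * (g2 y)%:E)%E); last by [].
exact: integrableZr.
Qed.

End fubini_real.

(** * The cosine transform *)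

Section tail.
Variable K : realType.
Local Notation mu := (@lebesgue_measure K).
Variables (rho V : K -> K) (b : K).
Hypotheses (irho : mu.-integrable setT (EFin \o rho))
  (V_ni : forall x y, x <= y -> V y <= V x) (V_ge0 : forall x, 0 <= V x)
  (iV : mu.-integrable `[b, +oo[ (EFin \o V))
  (rhoV : forall x y, b <= x -> x <= y -> `|rho x - rho y| <= V x - V y).

Lemma integrable_measurable_real (D : set K) (f : K -> K) :
  mu.-integrable D (EFin \o f) -> measurable_fun D f.
Proof. by move=> /integrableP[/measurable_EFinP]. Qed.

Lemma measurable_cosM (t : K) : measurable_fun setT (fun x : K => cos (x * t)).
Proof.
apply: continuous_measurable_fun => x.
apply: continuous_comp; last exact: continuous_cos.
exact: mulrr_continuous.
Qed.

(* Otherwise |rho| would be bounded below by a positive number on [x, +oo[. *)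
Lemma le_tail_variation x : b <= x -> `|rho x| <= V x.
Proof.
move=> bx; rewrite leNgt; apply/negP => Vrho.
pose e := `|rho x| - V x; have e0 : 0 < e by rewrite /e; lra.
have : mu.-integrable `[x, +oo[ (EFin \o cst e).
  apply: (@integrable_le _ _ _ (fun x => `|rho x|)) => //.
    apply: integrable_norm; exact: integrableS irho.
  move=> y; rewrite /= in_itv/= andbT => xy.
  have := rhoV bx xy; have := V_ge0 y.
  have := ler_normD (rho y) (rho x - rho y).
  rewrite (_ : rho y + _ = rho x); last by ring.
  move=> h1 h2 h3; rewrite gtr0_norm//. rewrite /e; lra.
move=> /integrableP[_]; rewrite /= integral_cst//=.
by rewrite lebesgue_measure_itv/= ltry mulry gtr0_sg ?normr_gt0 ?gt_eqF// mul1e.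
Qed.

(* Shifting by the half period h changes the sign of the cosine, so twice the
   integral is an integral over [A, A + h[ plus the integral over [A, +oo[ of
   (rho x - rho (x + h)) cos (x t). *)
Lemma tail_cos_le A t : b <= A -> 0 < t ->
  `|\int[mu]_(x in `[A, +oo[) (rho x * cos (x * t))| <= pi * V A / t.
Proof.
move=> bA t0; pose h := pi / t.
have h0 : 0 < h by rewrite divr_gt0// pi_gt0.
have mrho := integrable_measurable_real irho.
have mV : measurable_fun setT V.
  by apply: nonincreasing_measurable => // x y _ _; exact: V_ni.
have mc := measurable_cosM t.
pose f x := rho x * cos (x * t).
have mf : measurable_fun setT f by exact: measurable_funM.
have if_ : mu.-integrable setT (EFin \o f).
  apply: (@integrable_le _ _ _ (fun x => `|rho x|)) => //.
    exact: integrable_norm.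
  by move=> x _; rewrite normrM ler_piMr// cos_max.
have iVA (c : K) : A <= c -> mu.-integrable `[c, +oo[ (EFin \o V).
  by move=> Ac; apply: integrableS iV => //; apply: subset_itvr; rewrite bnd_simp (le_trans bA).
have pre c : (+%R^~ h) @^-1` `[c + h, +oo[%classic = `[c, +oo[%classic :> set K.
  by apply/seteqP; split => x /=; rewrite !in_itv/= !andbT lerD2r.
have split_ (g : K -> K) : mu.-integrable `[A, +oo[ (EFin \o g) ->
  \int[mu]_(x in `[A, +oo[) g x =
  \int[mu]_(x in `[A, A + h[) g x + \int[mu]_(x in `[A + h, +oo[) g x.
  move=> ig; rewrite -Rintegral_setU//.
  - by rewrite -(@itv_bndbnd_setU _ _ _ (BLeft (A + h)))// bnd_simp lerDl ltW.
  - by rewrite -(@itv_bndbnd_setU _ _ _ (BLeft (A + h)))// bnd_simp lerDl ltW.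
  - by apply/disj_setPS => x /=; rewrite !in_itv/= => -[/andP[_]]; rewrite andbT ltNge => /negP.
have ifA : mu.-integrable `[A, +oo[ (EFin \o f) by exact: integrableS if_.
have ifh : mu.-integrable `[A, +oo[ (EFin \o (fun x => f (x + h))).
  by rewrite -pre; apply: integrable_shift => //; exact: integrableS if_.
have iVh : mu.-integrable `[A, +oo[ (EFin \o (fun x => V (x + h))).
  by rewrite -pre; apply: integrable_shift => //; apply: iVA; lra.
have Sf : \int[mu]_(x in `[A + h, +oo[) f x = \int[mu]_(x in `[A, +oo[) f (x + h).
  by rewrite -(@Rintegral_shift _ h)// ?pre//; exact: integrableS if_.
have SV : \int[mu]_(x in `[A + h, +oo[) V x = \int[mu]_(x in `[A, +oo[) V (x + h).
  by rewrite -(@Rintegral_shift _ h)// ?pre//; apply: iVA; lra.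
have VJ : \int[mu]_(x in `[A, A + h[) V x <= h * V A.
  apply: (@le_trans _ _ (\int[mu]_(x in `[A, A + h[) V A)).
    apply: le_Rintegral => //.
    - by apply: integrableS (iVA A _) => //; exact: subset_itvl.
    - by apply: (@integrable_bounded _ _ _ `|V A|) => //; exact: lebesgue_measure_itv_lty.
    - by move=> x /=; rewrite in_itv/= => /andP[Ax _]; exact: V_ni.
  rewrite Rintegral_cst//. rewrite /= lebesgue_measure_itv/= lte_fin ltrDl h0 -EFinD/=.
  by rewrite addrAC subrr add0r mulrC.
have JV : `|\int[mu]_(x in `[A, A + h[) f x| <= \int[mu]_(x in `[A, A + h[) V x.
  apply: normr_Rintegral_le => //.
  - exact: measurable_funTS.
  - by apply: integrableS (iVA A _) => //; exact: subset_itvl.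
  - move=> x /=; rewrite in_itv/= => /andP[Ax _].
    apply: le_trans (le_tail_variation (le_trans bA Ax)).
    by rewrite normrM ler_piMr// cos_max.
(* The integral of [V x - V (x + h)] over [A, +oo[ collapses to that of [V] over one half period.
   Thus both terms of 2 I = (I + I') + J below are bounded by the same integral, itself at most
   [h * V A]. *)
have LV : `|\int[mu]_(x in `[A, +oo[) (f x + f (x + h))| <= \int[mu]_(x in `[A, A + h[) V x.
  have -> : \int[mu]_(x in `[A, A + h[) V x = \int[mu]_(x in `[A, +oo[) (V x - V (x + h)).
    by rewrite RintegralB ?iVA// (split_ V) ?iVA// SV addrK.
  apply: normr_Rintegral_le => //.
  - apply: measurable_funD; apply: (@integrable_measurable_real) => //.
  - rewrite (_ : _ \o _ = (EFin \o V) \- (EFin \o (fun x => V (x + h))))%E//.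
    by apply: integrableB => //; exact: iVA.
  - move=> x /=; rewrite in_itv/= andbT => Ax.
    rewrite /f mulrDl /h [pi / t * t]divfK ?gt_eqF// cosDpi mulrN -mulrBl -/h.
    rewrite normrM; apply: (@le_trans _ _ (`|rho x - rho (x + h)|)).
      by rewrite ler_piMr// cos_max.
    by apply: rhoV; [exact: le_trans Ax|rewrite lerDl ltW].
move: LV; rewrite RintegralD// -Sf.
have := split_ f ifA.
set I := \int[mu]_(x in `[A, +oo[) f x; set J := \int[mu]_(x in `[A, A + h[) f x.
set I' := \int[mu]_(x in `[A + h, +oo[) f x.
move: VJ JV; set J' := \int[mu]_(x in `[A, A + h[) V x => VJ JV IE LV.
rewrite -/(f _) (_ : pi * V A / t = h * V A); last by rewrite /h mulrAC.
have : 2 * I = (I + I') + J by lra.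
move=> I2; have : `|2 * I| <= J' + J' by rewrite I2 (le_trans (ler_normD _ _))// lerD.
by rewrite normrM ger0_norm//; lra.
Qed.

End tail.

Section measurable_inv.
Variable K : realType.
Lemma measurable_invr : measurable_fun setT (@GRing.inv K).
Proof.
(* The inverse of 0 is a default value, so this point is split off; on its complement the inverse is
   continuous. *)
rewrite (_ : setT = [set 0] `|` ~` [set (0 : K)]); last by rewrite setUv.
apply/measurable_funU => //; first exact: measurableC.
split; first exact: measurable_fun_set1.
apply: open_continuous_measurable_fun; first exact: closed_openC.
by move=> x; rewrite inE /= => x0; apply: inv_continuous; apply/eqP.
Qed.

Lemma cos_sub1_le (y : K) : 0 <= y -> `|cos y - 1| <= y.
Proof.
move=> y0.
have [|c _] := @MVT_segment _ cos (fun x => - sin x) 0 y y0.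
  by apply: continuous_subspaceT => x; exact: continuous_cos.
by rewrite cos0 subr0 => ->; rewrite normrM normrN (ger0_norm y0) ler_piMl// sin_max.
Qed.

End measurable_inv.

(** * Averaging over a window *)

Section average.
Variable K : realType.
Local Notation mu := (@lebesgue_measure K).
Local Notation T := (measurableTypeR K).
Implicit Types (g h : K -> K) (B : K).

(** The condition on the product is symmetric: it is read as an interval in [u] for fixed [t], and
    as an interval in [t] once the integrals are exchanged. *)
Lemma window_indicE (c x : K) : 0 < c ->
  \1_`[2^-1, 1]%classic (x * c) = \1_`[(2 * c)^-1, c^-1]%classic x :> K.
Proof.
move=> c0; rewrite !indicE; congr (_%:R); apply: congr1.
have h1 : (2^-1 <= x * c) = ((2 * c)^-1 <= x) by rewrite invfM ler_pdivrMr.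
have h2 : (x * c <= 1) = (x <= c^-1) by rewrite -ler_pdivlMr// div1r.
by apply/idP/idP; rewrite !inE /= !in_itv/= h1 h2.
Qed.

(* The u with 1/2 <= t u <= 1 form an interval of length 1/(2t): averaging over
   it replaces the change of variables u = 1/t. *)
Lemma average_integrable g h B : 0 < B ->
  measurable_fun setT g -> measurable_fun setT h ->
  (forall u, B <= u -> 0 <= h u) ->
  (forall t u, 0 < t -> B <= u -> 2^-1 <= t * u <= 1 -> `|g t| <= h u) ->
  mu.-integrable `[B, +oo[ (EFin \o (fun u => h u / u)) ->
  mu.-integrable `]0, (2 * B)^-1[ (EFin \o (fun t => g t / t)).
Proof.
move=> B0 mg mh h0 gh /integrableP[_ ih].
have mgt : measurable_fun setT (fun t : K => g t / t).
  apply: measurable_funM => //; exact: measurable_invr.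
apply/integrableP; split.
  by apply/measurable_EFinP; exact: measurable_funTS.
(* The 2 compensates for the window lengths 1/(2t) and 1/(2u): the integral of [f t u] in [u] is at
   least [|g t| / t], and its integral in [t] is at most [h u / u]. *)
pose f (t u : K) := 2 * \1_`[2^-1, 1]%classic (t * u) * h u.
have mf : measurable_fun setT (fun z : T * T => f z.1 z.2).
  apply: measurable_funM; last by apply: measurableT_comp.
  apply: measurable_funM => //.
  apply: measurableT_comp; first exact: measurable_indic.
  exact: measurable_funM.
have fE (t u : K) : 0 < t -> f t u = 2 * h u * \1_`[(2 * t)^-1, t^-1]%classic u.
  by move=> t0; rewrite /f mulrC (mulrC t) window_indicE//; ring.
have fE' (t u : K) : 0 < u -> f t u = 2 * h u * \1_`[(2 * u)^-1, u^-1]%classic t.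
  by move=> u0; rewrite /f window_indicE//; ring.
have itvlen (c : K) : 0 < c -> mu `[(2 * c)^-1, c^-1]%classic = (2 * c)^-1%:E.
  move=> c0; rewrite /= lebesgue_measure_itv/= lte_fin.
  have -> : (2 * c)^-1 < c^-1 by rewrite ltf_pV2 ?posrE ?mulr_gt0//; lra.
  by rewrite -EFinD; congr EFin; field; rewrite gt_eqF.
have f_ge0 t u : B <= u -> 0 <= f t u.
  by move=> Bu; rewrite /f indicE !mulr_ge0// h0.
pose I : \bar K := (\int[mu]_(t in `]0%R, (2 * B)^-1%R[) \int[mu]_(u in `[B, +oo[) (f t u)%:E)%E.
apply: (@le_lt_trans _ _ I).
  apply: ge0_le_integral => //.
  - by apply: measurableT_comp => //; apply/measurable_EFinP; exact: measurable_funTS.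
  - apply: measurable_integral1 => // t u _ /=; rewrite in_itv/= andbT; exact: f_ge0.
  - move=> t /=; rewrite in_itv/= => /andP[t0 tB].
    (* This is why [t] stops at [(2 * B)^-1]: the whole window then lies in [B, +oo[, where [h] is
       controlled. *)
    have Bt : B <= (2 * t)^-1.
      rewrite -[leLHS]invrK lef_pV2 ?posrE ?invr_gt0 ?mulr_gt0//.
      by move: tB; rewrite invfM; lra.
    apply: (@le_trans _ _ (\int[mu]_(u in `[B, +oo[)
        ((2 * `|g t|)%:E * (\1_`[(2 * t)^-1, t^-1]%classic u)%:E))%E).
      rewrite ge0_integralZl//; last by apply/measurable_EFinP; exact: measurable_indic.
      rewrite integral_indic// setIidl; last first.
        by apply: subset_itv; rewrite bnd_simp.
      rewrite [X in (_ <= _ * X)%E](itvlen t t0) -EFinM lee_fin normrM normfV (gtr0_norm t0).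
      by rewrite invfM mulrACA mulfV// mul1r.
    apply: ge0_le_integral => //.
    - by apply/measurable_EFinP; apply: measurable_funM => //;
      apply: measurable_funTS; exact: measurable_indic.
    - apply/measurable_EFinP; apply: measurable_funTS.
      by have := measurableT_comp mf (pair1_measurable (t : T)).
    - move=> u /=; rewrite in_itv/= andbT => Bu; rewrite -EFinM lee_fin fE// indicE.
      case: (boolP (u \in _)) => [|_]; last by rewrite !mulr0.
      rewrite inE/= in_itv/= !mulr1 => /andP[u1 u2].
      rewrite ler_pM2l//; apply: gh => //.
      move: u1 u2; rewrite invfM ler_pdivrMr// mulrC => ->/=.
      by rewrite -[t^-1]mul1r ler_pdivlMr// mulrC.
rewrite /I tonelli_real//; last by move=> t u _ /=; rewrite in_itv/= andbT; exact: f_ge0.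
apply: le_lt_trans ih; apply: ge0_le_integral => //.
- by move=> u /=; rewrite in_itv/= andbT => Bu; apply: integral_ge0 => t _; rewrite lee_fin f_ge0.
- apply: measurable_integral2 => // t u _ /=; rewrite in_itv/= andbT; exact: f_ge0.
- apply: measurableT_comp => //; apply/measurable_EFinP; apply: measurable_funTS.
  apply: measurable_funM => //; exact: measurable_invr.
move=> u /=; rewrite in_itv/= andbT => Bu.
have u0 : 0 < u by exact: lt_le_trans Bu.
under eq_integral do rewrite fE'// EFinM.
rewrite ge0_integralZl//; last 2 first.
- by apply/measurable_EFinP; exact: measurable_indic.
- by rewrite lee_fin mulr_ge0// h0.
rewrite integral_indic//.
pose M : set K := `[(2 * u)^-1, u^-1]%classic.
apply: (@le_trans _ _ ((2 * h u)%:E * mu M)%E).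
  apply: lee_pmul => //; first by rewrite lee_fin mulr_ge0// h0.
  have mM : measurable M by exact: measurable_itv.
  have mMD : measurable (M `&` `]0, (2 * B)^-1[%classic) by exact: measurableI.
  by apply: le_measure; rewrite ?inE.
rewrite [X in (_ * X <= _)%E](itvlen u u0) -EFinM lee_fin normrM.
rewrite (ger0_norm (h0 _ Bu)) gtr0_norm ?invr_gt0//.
by rewrite invfM mulrACA mulfV// mul1r.
Qed.

End average.

(** * Measurability and weighted integrability of primitives *)

Section primitive.
Variable K : realType.
Local Notation mu := (@lebesgue_measure K).
Local Notation T := (measurableTypeR K).

Lemma measurable_ge0_primitive (f : K -> K) :
  (forall u, mu.-integrable `[0, u] (EFin \o f)) -> (forall x, 0 <= x -> 0 <= f x) ->
  measurable_fun setT (fun u : K => \int[mu]_(x in `[0, u]) f x).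
Proof.
move=> intf f0; apply: nondecreasing_measurable => // u v uv.
apply: fine_le.
- exact: integrable_fin_num.
- exact: integrable_fin_num.
apply: ge0_subset_integral => //.
- by have /integrableP[] := intf v.
- by move=> x /=; rewrite in_itv/= => /andP[x0 _]; rewrite lee_fin f0.
- by apply: subset_itvl; rewrite bnd_simp.
Qed.

(** A primitive of a nonnegative function is monotone, hence measurable; a general [f] is the
    difference of f + |f| and |f|. *)
Lemma measurable_primitive (f : K -> K) : mu.-integrable setT (EFin \o f) ->
  measurable_fun setT (fun u : K => \int[mu]_(x in `[0, u]) f x).
Proof.
move=> intf.
have intn : mu.-integrable setT (EFin \o (fun x => `|f x|)) by exact: integrable_norm.
have intp : mu.-integrable setT (EFin \o (fun x => f x + `|f x|)).
  rewrite (_ : _ \o _ = ((EFin \o f) \+ (EFin \o (fun x : K => (`|f x|)%R)))%E)//.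
  exact: integrableD.
rewrite (_ : (fun u : K => _) = (fun u : K => \int[mu]_(x in `[0, u]) (f x + `|f x|)) \-
    (fun u : K => \int[mu]_(x in `[0, u]) `|f x|)); last first.
  apply/funext => u /=; rewrite RintegralD//; last 2 first.
  - exact: integrableS intf.
  - exact: integrableS intn.
  by rewrite addrK.
apply: measurable_funB; apply: measurable_ge0_primitive => //.
- by move=> u; exact: integrableS intp.
- by move=> x _; have := ler_norm (- f x); rewrite normrN; lra.
- by move=> u; exact: integrableS intn.
Qed.

Lemma integral_inv_sqr (c : K) : 0 < c ->
  (\int[mu]_(u in `[c, +oo[) (u^-1 / u)%:E = c^-1%:E)%E.
Proof.
move=> c0.
have dF (x : K) : 0 < x -> is_derive x 1 (fun u : K => - u^-1) (x^-1 / x).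
  move=> x0; have xn0 : x != 0 by rewrite gt_eqF.
  have d1 := @is_deriveV _ (@idfun K) x 1 1 xn0 (is_derive_id x 1).
  apply: is_derive_eq (is_deriveN d1) _.
  by rewrite [_ *: 1]mulr1 opprK -exprVn expr2.
rewrite (@ge0_continuous_FTC2y _ (fun u => u^-1 / u) (fun u => - u^-1) c 0).
- by rewrite -EFinB sub0r opprK.
- by move=> x cx; rewrite mulr_ge0// invr_ge0; lra.
- apply: continuous_in_subspaceT => x; rewrite inE/= in_itv/= andbT => cx.
  have xn0 : x != 0 by rewrite gt_eqF//; lra.
  by apply: continuousM; exact: inv_continuous.
- rewrite -[X in _ --> X]oppr0; apply: cvgN.
  apply/gtr0_cvgV0; last exact: cvg_id.
  exact: nbhs_pinfty_gt.
- by move=> x cx; have /= [] := dF x (lt_trans c0 cx).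
- apply: cvg_at_right_filter; apply: cvgN; apply: inv_continuous; rewrite gt_eqF//.
- move=> x; rewrite in_itv/= andbT => cx; rewrite derive1E.
  by apply: derive_val; exact: dF (lt_trans c0 cx).
Unshelve. all: by end_near. Qed.

Lemma integrable_norm_mulr (rho : K -> K) (u : K) :
  mu.-integrable setT (EFin \o rho) ->
  mu.-integrable `[0, u] (EFin \o (fun x => `|rho x| * x)).
Proof.
move=> irho; apply: (@integrable_le _ _ _ (fun x => `|rho x| * u)) => //.
- apply: measurable_funTS; apply: measurable_funM => //.
  by apply: measurableT_comp => //; exact: integrable_measurable_real irho.
- rewrite (_ : _ \o _ = (fun x => (EFin \o (fun x => (`|rho x|)%R)) x * u%:E)%E)//.
  by apply: integrableZr => //; apply: integrable_norm; exact: integrableS irho.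
- move=> x /=; rewrite in_itv/= => /andP[x0 xu].
  by rewrite normrM normr_id ger0_norm// ler_wpM2l.
Qed.

(** By Tonelli's theorem, x |rho x| gets multiplied by at most the integral of u^-2 over [x, +oo[,
    which is 1/x; what remains is the integral of |rho|. *)
Lemma integrable_weighted_primitive (rho : K -> K) (B : K) : 0 < B ->
  mu.-integrable setT (EFin \o rho) ->
  mu.-integrable `[B, +oo[
    (EFin \o (fun u => (\int[mu]_(x in `[0, u]) (`|rho x| * x)) / u / u)).
Proof.
move=> B0 irho.
have mrho := integrable_measurable_real irho.
have mn : measurable_fun setT (fun x => `|rho x| * x).
  by apply: measurable_funM => //; exact: measurableT_comp.
have iN (u : K) := integrable_norm_mulr u irho.
have mN : measurable_fun setT (fun u : K => \int[mu]_(x in `[0, u]) (`|rho x| * x)).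
  by apply: measurable_ge0_primitive => // x x0; rewrite mulr_ge0.
apply/integrableP; split.
  apply/measurable_EFinP; apply: measurable_funTS.
  by do 2! (apply: measurable_funM; last exact: measurable_invr).
pose f (u x : K) := `|rho x| * x * \1_`[x, +oo[%classic u * (u^-1 / u).
(* The condition x <= u becomes a condition on the single variable u - x, which makes joint
   measurability a matter of composition. *)
have fE u x : f u x = `|rho x| * x * \1_`[0, +oo[%classic (u - x) * (u^-1 / u).
  rewrite /f !indicE; congr (_ * _%:R * _); apply: congr1.
  by apply/idP/idP; rewrite !inE/= !in_itv/= subr_ge0.
have mf : measurable_fun setT (fun z : T * T => f z.1 z.2).
  under eq_fun do rewrite fE.
  apply: measurable_funM.
    apply: measurable_funM; first exact: (measurableT_comp mn).
    apply: measurableT_comp; first exact: measurable_indic.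
    exact: measurable_funB.
  by apply: measurable_funM; apply: (measurableT_comp (@measurable_invr K)).
have f0 u x : 0 <= u -> 0 <= x -> 0 <= f u x.
  by move=> u0 x0; rewrite /f indicE !mulr_ge0// ?invr_ge0.
(* The point x = 0 is left out because u^-2 has a finite integral over [x, +oo[ only for x > 0. *)
apply: (@le_lt_trans _ _ (\int[mu]_(u in `[B, +oo[) \int[mu]_(x in `]0%R, +oo[) (f u x)%:E)%E).
  apply: ge0_le_integral => //.
  - apply: measurableT_comp => //; apply/measurable_EFinP; apply: measurable_funTS.
    by do 2! (apply: measurable_funM; last exact: measurable_invr).
  - apply: measurable_integral1 => // u x /=; rewrite !in_itv/= !andbT => uB x0.
    by apply: f0; lra.
  move=> u /=; rewrite in_itv/= andbT => Bu.
  have u0 : 0 < u by lra.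
  have u0' := ltW u0.
  rewrite ger0_norm; last first.
    rewrite !mulr_ge0 ?invr_ge0// Rintegral_ge0// => x /=.
    by rewrite in_itv/= => /andP[x0 _]; rewrite mulr_ge0.
  rewrite -mulrA EFinM fineK; last exact: integrable_fin_num (iN u).
  rewrite -ge0_integralZr//; last 3 first.
  - by have /integrableP[] := iN u.
  - by move=> x /=; rewrite in_itv/= => /andP[x0 _]; rewrite lee_fin mulr_ge0.
  - by rewrite lee_fin mulr_ge0 ?invr_ge0.
  rewrite -integral_itv_obnd_cbnd; last first.
    apply/measurable_EFinP; apply: measurable_funTS; exact: measurable_funM.
  apply: (@le_trans _ _ (\int[mu]_(x in `]0%R, u]) (f u x)%:E)%E).
    apply: ge0_le_integral => //.
    - move=> x /=; rewrite in_itv/= => /andP[/ltW x0 _].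
      by rewrite -EFinM lee_fin !mulr_ge0 ?invr_ge0.
    - apply: emeasurable_funM => //; apply/measurable_EFinP; exact: measurable_funTS.
    - apply/measurable_EFinP; apply: measurable_funTS.
      by have := measurableT_comp mf (pair1_measurable (u : T)).
    - move=> x /=; rewrite in_itv/= => /andP[x0 xu].
      by rewrite /f indicE mem_set/= ?in_itv/= ?xu// mulr1 EFinM.
  apply: ge0_subset_integral => //.
  - apply/measurable_EFinP; apply: measurable_funTS.
    by have := measurableT_comp mf (pair1_measurable (u : T)).
  - by move=> x /=; rewrite in_itv/= andbT => x0; rewrite lee_fin f0// ltW.
  - by apply: subset_itvl; rewrite bnd_simp.
rewrite tonelli_real//; last first.
  by move=> u x /=; rewrite !in_itv/= !andbT => uB x0; apply: f0; lra.
have /integrableP[_] : mu.-integrable `]0, +oo[ (EFin \o rho) by exact: integrableS irho.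
apply: le_lt_trans; apply: ge0_le_integral => //.
- move=> x /=; rewrite in_itv/= andbT => x0; apply: integral_ge0 => u /=.
  by rewrite in_itv/= andbT => Bu; rewrite lee_fin f0//; lra.
- apply: measurable_integral2 => // u x /=; rewrite !in_itv/= !andbT => uB x0.
  by apply: f0; lra.
- by apply: measurableT_comp => //; apply/measurable_EFinP; exact: measurable_funTS.
move=> x /=; rewrite in_itv/= andbT => x0.
apply: (@le_trans _ _ (\int[mu]_(u in `[x, +oo[) ((`|rho x| * x)%:E * (u^-1 / u)%:E))%E); last first.
  rewrite ge0_integralZl//; last 3 first.
  - apply/measurable_EFinP; apply: measurable_funTS.
    by apply: measurable_funM; exact: measurable_invr.
  - move=> u /=; rewrite in_itv/= andbT => xu; rewrite lee_fin mulr_ge0 ?invr_ge0//; lra.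
  - by rewrite lee_fin mulr_ge0// ltW.
  by rewrite integral_inv_sqr// -EFinM mulfK ?gt_eqF.
rewrite [leLHS]integral_mkcond [leRHS]integral_mkcond; apply: ge0_le_integral => //.
- move=> u _; apply: erestrict_ge0 => v /=; rewrite in_itv/= andbT => Bv.
  by rewrite lee_fin f0//; lra.
- apply/(measurable_restrictT _ _).1 => //; apply/measurable_EFinP; apply: measurable_funTS.
  by have := measurableT_comp mf (pair2_measurable (x : T)).
- apply/(measurable_restrictT _ _).1 => //; apply/measurable_EFinP; apply: measurable_funTS.
  by do 2! apply: measurable_funM => //; exact: measurable_invr.
move=> u _; rewrite !patchE.
case: (boolP (u \in _)) => uB; case: (boolP (u \in _)) => ux //.
- by rewrite /f -EFinM indicE ux mulr1.
- by rewrite /f indicE (negbTE ux) mulr0 mul0r.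
- move: ux; rewrite inE/= in_itv/= andbT => xu.
  by rewrite -EFinM lee_fin !mulr_ge0 ?invr_ge0//; lra.
Qed.

End primitive.

Lemma continuous_Rintegral_cos (K : realType) (D : set K) (f : K -> K) :
  measurable D -> lebesgue_measure.-integrable D (EFin \o f) ->
  continuous (fun t => \int[lebesgue_measure]_(x in D) (f x * cos (x * t))).
Proof.
move=> mD if_ t.
have := @continuity_under_integral K _ _ lebesgue_measure (fun t x => f x * cos (x * t)) D
  mD (t - 1) (t + 1).
have f_le s x : D x -> `|f x * cos (x * s)| <= `|f x|.
  by move=> _; rewrite normrM ler_piMr// cos_max.
move=> h; apply: (h _ _ (fun x => `|f x|)).
- move=> s _; apply: (@integrable_le _ _ _ (fun x => `|f x|)) => //.
  + apply: measurable_funM; last by apply: measurable_funTS; exact: measurable_cosM.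
    exact: integrable_measurable_real if_.
  + exact: integrable_norm.
  + by move=> x; exact: f_le.
- apply: aeW => x _ s _; apply: continuousM; first exact: cst_continuous.
  apply: continuous_comp; last exact: continuous_cos.
  exact: mulrl_continuous.
- exact: integrable_norm.
- by move=> s _; apply: aeW => x; exact: f_le.
- by rewrite inE /= in_itv/=; apply/andP; split; lra.
Qed.

(** * Integrability of G(t)/t *)

Section cosine_transform.
Variable K : realType.
Local Notation mu := (@lebesgue_measure K).
Variables (rho : K -> K).
Hypothesis (irho : mu.-integrable setT (EFin \o rho)).

(** This is G, with [rho] in the role of r'. *)
Definition cosT (t : K) : K := \int[mu]_(x in `[0, +oo[) (rho x * cos (x * t)).

Let mrho : measurable_fun setT rho. Proof. exact: integrable_measurable_real irho. Qed.

Lemma measurable_Mcos (t : K) : measurable_fun setT (fun x => rho x * cos (x * t)).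
Proof. by apply: measurable_funM => //; exact: measurable_cosM. Qed.

Lemma integrable_Mcos (D : set K) (t : K) : measurable D ->
  mu.-integrable D (EFin \o (fun x => rho x * cos (x * t))).
Proof.
move=> mD; apply: (@integrable_le _ _ _ (fun x => `|rho x|)) => //.
- by apply: measurable_funTS; exact: measurable_Mcos.
- by apply: integrable_norm; exact: integrableS irho.
- by move=> x _; rewrite normrM ler_piMr// cos_max.
Qed.

Lemma cosT_le t : `|cosT t| <= \int[mu]_(x in `[0, +oo[) `|rho x|.
Proof.
apply: normr_Rintegral_le => //.
- by apply: measurable_funTS; exact: measurable_Mcos.
- by apply: integrable_norm; exact: integrableS irho.
- by move=> x _; rewrite normrM ler_piMr// cos_max.
Qed.

Lemma continuous_cosT : continuous cosT.
Proof. by apply: continuous_Rintegral_cos => //; exact: integrableS irho. Qed.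

Lemma measurable_cosT : measurable_fun setT cosT.
Proof. by apply: continuous_measurable_fun; exact: continuous_cosT. Qed.

Lemma cosT_split u t : 0 <= u -> cosT t =
  \int[mu]_(x in `[0, u]) (rho x * cos (x * t)) +
  \int[mu]_(x in `[u, +oo[) (rho x * cos (x * t)).
Proof.
move=> u0; rewrite -(@Rintegral_itv_obnd_cbnd _ u)//; last exact: integrable_Mcos.
rewrite /cosT -(@Rintegral_itvB _ _ (BLeft 0) (BInfty _ false) u)//; last exact: integrable_Mcos.
by rewrite addrC subrK.
Qed.

Variables (V : K -> K) (b : K).
Hypotheses (b0 : 0 <= b)
  (V_ni : forall x y, x <= y -> V y <= V x) (V_ge0 : forall x, 0 <= V x)
  (iV : mu.-integrable `[b, +oo[ (EFin \o V))
  (rhoV : forall x y, b <= x -> x <= y -> `|rho x - rho y| <= V x - V y)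
  (iprim : mu.-integrable `]0, +oo[ (EFin \o (fun u => (\int[mu]_(x in `[0, u]) rho x) / u)))
  (ihead : mu.-integrable `[1, +oo[
     (EFin \o (fun t => (\int[mu]_(x in `[0, b]) (rho x * cos (x * t))) / t))).

(** Below [u], cos(xt) is split as 1 + (cos(xt) - 1): the first part gives the primitive, and the
    second is at most xt <= x/u because tu <= 1. Above [u], the half-period estimate applies, with
    1/t <= 2u because tu >= 1/2. *)
Lemma cosT_window t u : 0 < t -> b <= u -> 0 < u -> 2^-1 <= t * u <= 1 ->
  `|cosT t| <= `|\int[mu]_(x in `[0, u]) rho x| +
     (\int[mu]_(x in `[0, u]) (`|rho x| * x)) / u + 2 * pi * u * V u.
Proof.
move=> t0 bu u0 /andP[tu1 tu2].
rewrite (cosT_split t (ltW u0)).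
have iu : mu.-integrable `[0, u] (EFin \o rho) by exact: integrableS irho.
have imu := integrable_norm_mulr u irho.
have -> : \int[mu]_(x in `[0, u]) (rho x * cos (x * t)) =
    \int[mu]_(x in `[0, u]) rho x + \int[mu]_(x in `[0, u]) (rho x * (cos (x * t) - 1)).
  have -> : \int[mu]_(x in `[0, u]) (rho x * (cos (x * t) - 1)) =
      \int[mu]_(x in `[0, u]) (rho x * cos (x * t)) - \int[mu]_(x in `[0, u]) rho x.
    rewrite -RintegralB//; last exact: integrable_Mcos.
    by apply: eq_Rintegral => x _; ring.
  by rewrite addrC subrK.
have H2 : `|\int[mu]_(x in `[0, u]) (rho x * (cos (x * t) - 1))| <=
    (\int[mu]_(x in `[0, u]) (`|rho x| * x)) / u.
  rewrite -RintegralZr//; apply: normr_Rintegral_le => //.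
  - apply: measurable_funTS; apply: measurable_funM => //.
    by apply: measurable_funB => //; exact: measurable_cosM.
  - rewrite (_ : _ \o _ = (fun x => (EFin \o (fun x => `|rho x| * x)%R) x * (u^-1)%:E)%E)//.
    exact: integrableZr.
  - move=> x /=; rewrite in_itv/= => /andP[x0 xu].
    rewrite normrM -mulrA ler_wpM2l//.
    apply: (le_trans (cos_sub1_le _)); first by rewrite mulr_ge0// ltW.
    by rewrite ler_wpM2l// -div1r ler_pdivlMr.
have H3 := tail_cos_le irho V_ni V_ge0 iV rhoV bu t0.
have H4 : pi * V u / t <= 2 * pi * u * V u.
  rewrite ler_pdivrMr//.
  have : 0 <= pi * V u by rewrite mulr_ge0// pi_ge0.
  move=> piV; rewrite (_ : _ * t = pi * V u * (2 * (t * u))); last by ring.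
  by rewrite ler_peMr//; lra.
rewrite -addrA; apply: (le_trans (ler_normD _ _)).
rewrite -addrA; apply: lerD => //.
by apply: (le_trans (ler_normD _ _)); apply: lerD => //; exact: le_trans H4.
Qed.

Lemma integrable_cosT_div : mu.-integrable `]0, +oo[ (EFin \o (fun t => cosT t / t)).
Proof.
(* The tail estimates need u >= b; the 1 keeps [B] positive when [b] is 0. *)
pose B := Num.max b 1.
have bB : b <= B by rewrite le_max lexx.
have B1 : 1 <= B by rewrite le_max lexx orbT.
have B0 : 0 < B by lra.
have mct : measurable_fun setT (fun t : K => cosT t / t).
  by apply: measurable_funM; [exact: measurable_cosT|exact: measurable_invr].
have mV : measurable_fun setT V.
  by apply: nonincreasing_measurable => // x y; exact: V_ni.
have mn : measurable_fun setT (fun x => `|rho x| * x).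
  by apply: measurable_funM => //; exact: measurableT_comp.
have imu u := integrable_norm_mulr u irho.
have small : mu.-integrable `]0, (2 * B)^-1[ (EFin \o (fun t => cosT t / t)).
  apply: (@average_integrable _ cosT (fun u => `|\int[mu]_(x in `[0, u]) rho x| +
     (\int[mu]_(x in `[0, u]) (`|rho x| * x)) / u + 2 * pi * u * V u)) => //.
  - exact: measurable_cosT.
  - apply: measurable_funD; first apply: measurable_funD.
    + by apply: measurableT_comp => //; exact: measurable_primitive.
    + apply: measurable_funM; last exact: measurable_invr.
      by apply: measurable_ge0_primitive => // x x0; rewrite mulr_ge0.
    + by apply: measurable_funM => //; exact: measurable_funM.
  - move=> u Bu; have u0 : 0 <= u by lra.
    rewrite !addr_ge0// !mulr_ge0// ?pi_ge0 ?invr_ge0//.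
    by rewrite Rintegral_ge0// => x /=; rewrite in_itv/= => /andP[x0 _]; rewrite mulr_ge0.
  - by move=> t u t0 Bu; apply: cosT_window => //; lra.
  - have i1 : mu.-integrable `[B, +oo[ (EFin \o (fun u => `|(\int[mu]_(x in `[0, u]) rho x) / u|)).
      apply: integrable_norm; apply: integrableS iprim => //.
      by apply: subset_itvr; rewrite bnd_simp.
    have i2 := integrable_weighted_primitive B0 irho.
    have i3 : mu.-integrable `[B, +oo[ (EFin \o (fun u => 2 * pi * V u)).
      rewrite (_ : _ \o _ = (fun x => (2 * pi)%:E * (EFin \o V) x)%E)//.
      apply: integrableZl => //; apply: integrableS iV => //.
      by apply: subset_itvr; rewrite bnd_simp.
    have := integrable_add (measurable_itv `[B, +oo[) (integrable_add (measurable_itv `[B, +oo[) i1 i2) i3.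
    apply: eq_integrable => // u; rewrite inE/= in_itv/= andbT => Bu.
    have u0 : 0 < u by lra.
    rewrite /=; congr EFin; rewrite normrM normfV (gtr0_norm u0).
    by field; rewrite gt_eqF.
(* The integral over [0, b] is covered by [ihead]; the one over [b, +oo[ is at most pi V(b) / t, and
   division by [t] makes this integrable on [1, +oo[. *)
have large : mu.-integrable `[1, +oo[ (EFin \o (fun t : K => cosT t / t)).
  have mtail : measurable_fun (`[1, +oo[%classic : set K)
    (fun t : K => (\int[mu]_(x in `[b, +oo[) (rho x * cos (x * t))) / t).
    have m1 : measurable_fun (`[1, +oo[%classic : set K)
      (fun t : K => cosT t / t - (\int[mu]_(x in `[0, b]) (rho x * cos (x * t))) / t).
      apply: measurable_funB; first exact: measurable_funTS.
      exact: integrable_measurable_real ihead.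
    apply: eq_measurable_fun m1 => t _.
    by rewrite (cosT_split t b0); ring.
  have i1 : mu.-integrable `[1, +oo[
    (EFin \o (fun t : K => (\int[mu]_(x in `[b, +oo[) (rho x * cos (x * t))) / t)).
    apply: (@integrable_le _ _ _ (fun t : K => pi * V b * (t^-1 / t))) => //.
      rewrite (_ : _ \o _ = (fun x => (pi * V b)%:E * (EFin \o (fun t : K => t^-1 / t)%R) x)%E)//.
      apply: integrableZl => //; apply/integrableP; split.
        apply/measurable_EFinP; apply: measurable_funTS.
        by apply: measurable_funM; exact: measurable_invr.
      under eq_integral => t tt.
        rewrite gee0_abs/=; last first.
          move: tt; rewrite inE/= in_itv/= andbT => tt.
          by rewrite lee_fin mulr_ge0// invr_ge0; lra.
        over.
      by rewrite integral_inv_sqr// ltry.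
    move=> t /=; rewrite in_itv/= andbT => t1.
    have t0 : 0 < t by lra.
    rewrite normrM normfV (gtr0_norm t0) mulrA ler_wpM2r ?invr_ge0 ?(ltW t0)//.
    exact: (tail_cos_le irho V_ni V_ge0 iV rhoV (lexx b) t0).
  have := integrable_add (measurable_itv `[1, +oo[) ihead i1.
  apply: eq_integrable => // t _.
  by rewrite /=; congr EFin; rewrite (cosT_split t b0) mulrDl.
have d1 : (2 * B)^-1 <= 1 by rewrite invf_le1 ?mulr_gt0//; lra.
have d0 : 0 < (2 * B)^-1 by rewrite invr_gt0 mulr_gt0.
(* On the segment between the two ranges the quotient is bounded, since [cosT] is bounded and [t]
   stays away from 0. *)
have mid : mu.-integrable `[(2 * B)^-1, 1] (EFin \o (fun t => cosT t / t)).
  apply: (@integrable_bounded _ _ _ ((\int[mu]_(x in `[0, +oo[) `|rho x|) * (2 * B))) => //.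
  - exact: lebesgue_measure_itv_lty.
  - exact: measurable_funTS.
  - move=> t /=; rewrite in_itv/= => /andP[tB t1].
    have t0 : 0 < t by exact: lt_le_trans tB.
    rewrite normrM normfV (gtr0_norm t0) ler_pM ?invr_ge0 ?(ltW t0)//.
      exact: cosT_le.
    by rewrite -[leRHS]invrK lef_pV2// posrE.
have -> : `]0, +oo[%classic =
    `]0, (2 * B)^-1[%classic `|` (`[(2 * B)^-1, 1]%classic `|` `[1, +oo[%classic) :> set K.
  apply/seteqP; split => t /=; rewrite !in_itv/= ?andbT.
    move=> t0; have [tB|Bt] := ltP t (2 * B)^-1; first by left; rewrite t0.
    by right; have [t1|t1] := leP t 1; [left|right; rewrite ltW].
  by case=> [/andP[]//|[/andP[]|]]; lra.
apply: integrable_setU => //; last exact: integrable_setU.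
exact: measurableU.
Qed.

End cosine_transform.

(** * Inversion by Abel summation *)

Section abel_kernel.
Variable K : realType.
Local Notation mu := (@lebesgue_measure K).
Implicit Types (e s t a x y : K).

Lemma is_derive_comp_lin (f : K -> K) (df c x : K) :
  is_derive (c * x) 1 f df -> is_derive x 1 (fun t => f (c * t)) (c * df).
Proof.
move=> fdf.
have d1 : is_derive x 1 (fun t => c * t) c.
  have := @is_deriveZ _ _ _ id c x 1 1 (is_derive_id x 1).
  by rewrite [_ *: _]mulr1.
by have := is_derive1_comp fdf d1; rewrite mulrC.
Qed.

Lemma cvgr_expR_lin e : 0 < e -> expR (- e * t) @[t --> +oo] --> (0 : K).
Proof.
move=> e0; rewrite (_ : (fun x => _) = (fun z => expR (- z)) \o (fun z => e * z)); last first.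
  by apply: eq_fun => x; rewrite mulNr.
apply: (@cvg_comp _ _ _ _ _ _ (pinfty_nbhs K)); last exact: cvgr_expR.
exact: gt0_cvgMry.
Qed.

(* The term 1 in exp (- e t) (1 + cos (s t)) makes the integrand nonnegative,
   as the fundamental theorem of calculus on a half-line requires. *)
Definition abel_antiderivative e s t : K :=
  - (expR (- e * t) / e) +
  expR (- e * t) * ((s * sin (s * t) - e * cos (s * t)) / (e ^+ 2 + s ^+ 2)).

Lemma is_derive_abel_antiderivative e s t : 0 < e ->
  is_derive t 1 (abel_antiderivative e s) (expR (- e * t) * (1 + cos (s * t))).
Proof.
move=> e0.
have es0 : e ^+ 2 + s ^+ 2 != 0 by rewrite gt_eqF// ltr_pwDl// ?exprn_gt0// sqr_ge0.
have dE : is_derive t 1 (fun t => expR (- e * t)) (- e * expR (- e * t)).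
  exact: is_derive_comp_lin.
have dS : is_derive t 1 (fun t => sin (s * t)) (s * cos (s * t)).
  exact: is_derive_comp_lin.
have dC : is_derive t 1 (fun t => cos (s * t)) (s * - sin (s * t)).
  exact: is_derive_comp_lin.
have -> : abel_antiderivative e s =
    (- e^-1) \*: (fun t => expR (- e * t)) +
    (fun t => expR (- e * t)) *
    ((s / (e ^+ 2 + s ^+ 2)) \*: (fun t => sin (s * t)) -
     (e / (e ^+ 2 + s ^+ 2)) \*: (fun t => cos (s * t))).
  apply/funext => u; rewrite /abel_antiderivative !fctE /= /GRing.scale/=.
  by field; rewrite es0 gt_eqF.
have d := is_deriveD (is_deriveZ (- e^-1) dE) (is_deriveM dE (is_deriveB
  (is_deriveZ (s / (e ^+ 2 + s ^+ 2)) dS) (is_deriveZ (e / (e ^+ 2 + s ^+ 2)) dC))).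
apply: is_derive_eq d _.
rewrite !fctE /= /GRing.scale/=.
by field; rewrite es0 gt_eqF.
Qed.

Lemma cvgy_abel_antiderivative e s : 0 < e ->
  abel_antiderivative e s t @[t --> +oo] --> (0 : K).
Proof.
move=> e0.
have es0 : 0 < e ^+ 2 + s ^+ 2 by rewrite ltr_pwDl// ?exprn_gt0// sqr_ge0.
pose M := e^-1 + (`|s| + e) / (e ^+ 2 + s ^+ 2).
apply/norm_cvg0P; apply: (@squeeze_cvgr _ _ _ _ (cst 0) (fun t => expR (- e * t) * M)).
- apply: nearW => t; rewrite normr_ge0/=.
  rewrite /abel_antiderivative (le_trans (ler_normD _ _))// mulrDr; apply: lerD.
    by rewrite normrN ger0_norm// mulr_ge0// ?expR_ge0 ?invr_ge0 ?ltW.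
  rewrite normrM ger0_norm ?expR_ge0// ler_wpM2l ?expR_ge0//.
  rewrite normrM normfV (gtr0_norm es0) ler_wpM2r ?invr_ge0 ?(ltW es0)//.
  rewrite (le_trans (ler_normB _ _))// !normrM (gtr0_norm e0) lerD//.
    by rewrite ler_piMr// sin_max.
  by rewrite ler_piMr ?cos_max// ltW.
- exact: cvg_cst.
- rewrite -[X in _ --> X](mul0r M); apply: cvgM; last exact: cvg_cst.
  exact: cvgr_expR_lin.
Qed.

Lemma continuous_abel e s : continuous (fun t : K => expR (- e * t) * (1 + cos (s * t))).
Proof.
move=> t; apply: cvgM.
  apply: continuous_comp; [exact: mulrl_continuous|exact: continuous_expR].
apply: cvgD; first exact: cvg_cst.
by apply: continuous_comp; [exact: mulrl_continuous|exact: continuous_cos].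
Qed.

Lemma integral_exp_cos1 e s : 0 < e ->
  (\int[mu]_(t in `[0%R, +oo[) (expR (- e * t) * (1 + cos (s * t)))%:E =
   (e^-1 + e / (e ^+ 2 + s ^+ 2))%:E)%E.
Proof.
move=> e0.
have dF t := is_derive_abel_antiderivative s t e0.
rewrite (@ge0_continuous_FTC2y _ _ (abel_antiderivative e s) 0 0).
- rewrite /abel_antiderivative !mulr0 expR0 cos0 sin0 -EFinB; congr EFin.
  by rewrite mulr0; ring.
- move=> t _; rewrite mulr_ge0 ?expR_ge0//; have := cos_geN1 (s * t); lra.
- apply: continuous_subspaceT; exact: continuous_abel.
- exact: cvgy_abel_antiderivative.
- by move=> t _; have [] := dF t.
- apply: cvg_at_right_filter; apply: differentiable_continuous.
  by apply/derivable1_diffP; have [] := dF 0.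
- move=> t _; rewrite derive1E; have h := dF t; exact: derive_val.
Qed.

Lemma measurable_exp_cos e s : measurable_fun setT (fun t : K => expR (- e * t) * (1 + cos (s * t))).
Proof. by apply: continuous_measurable_fun; exact: continuous_abel. Qed.

Lemma measurable_exp_lin e : measurable_fun setT (fun t : K => expR (- e * t)).
Proof.
apply: continuous_measurable_fun => t.
apply: continuous_comp; [exact: mulrl_continuous|exact: continuous_expR].
Qed.

Lemma measurable_cos_lin s : measurable_fun setT (fun t : K => cos (s * t)).
Proof.
apply: continuous_measurable_fun => t.
apply: continuous_comp; [exact: mulrl_continuous|exact: continuous_cos].
Qed.

Lemma measurable_sin_lin s : measurable_fun setT (fun t : K => sin (s * t)).
Proof.
apply: continuous_measurable_fun => t.
apply: continuous_comp; [exact: mulrl_continuous|exact: continuous_sin].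
Qed.

Lemma integrable_exp_cos1 e s : 0 < e ->
  mu.-integrable `[0, +oo[ (EFin \o (fun t => expR (- e * t) * (1 + cos (s * t)))).
Proof.
move=> e0; apply/integrableP; split.
  by apply/measurable_EFinP; apply: measurable_funTS; exact: measurable_exp_cos.
under eq_integral => t _.
  rewrite gee0_abs/=; last first.
    by rewrite lee_fin mulr_ge0 ?expR_ge0//; have := cos_geN1 (s * t); lra.
  over.
by rewrite integral_exp_cos1// ltry.
Qed.

(** The case s = 0 of [integrable_exp_cos1], where 1 + cos(st) is 2. *)
Lemma integrable_exp_lin e : 0 < e -> mu.-integrable `[0, +oo[ (EFin \o (fun t => expR (- e * t))).
Proof.
move=> e0; have := integrable_mull 2^-1 (measurable_itv `[0, +oo[) (integrable_exp_cos1 0 e0).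
apply: eq_integrable => // t _ /=; congr EFin.
by rewrite mul0r cos0; field.
Qed.

Lemma Rintegral_exp_lin e : 0 < e -> \int[mu]_(t in `[0, +oo[) expR (- e * t) = e^-1.
Proof.
move=> e0.
have H : \int[mu]_(t in `[0, +oo[) (2 * expR (- e * t)) = 2 * e^-1.
  rewrite (_ : 2 * e^-1 = e^-1 + e / (e ^+ 2 + 0 ^+ 2)); last first.
    by field; rewrite gt_eqF.
  rewrite -[RHS]/(fine (_%:E)) -integral_exp_cos1//; congr fine.
  by apply: eq_integral => t _; rewrite mul0r cos0 mulrC.
move: H; rewrite RintegralZl//; last exact: integrable_exp_lin.
by move/mulfI; apply; rewrite pnatr_eq0.
Qed.

Lemma Rintegral_exp_cos e s : 0 < e ->
  \int[mu]_(t in `[0, +oo[) (expR (- e * t) * cos (s * t)) = e / (e ^+ 2 + s ^+ 2).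
Proof.
move=> e0.
have -> : \int[mu]_(t in `[0, +oo[) (expR (- e * t) * cos (s * t)) =
  \int[mu]_(t in `[0, +oo[) (expR (- e * t) * (1 + cos (s * t))) -
  \int[mu]_(t in `[0, +oo[) expR (- e * t).
  rewrite -RintegralB//; [|exact: integrable_exp_cos1|exact: integrable_exp_lin].
  by apply: eq_Rintegral => t _; ring.
by rewrite Rintegral_exp_lin// /Rintegral integral_exp_cos1//=; ring.
Qed.

End abel_kernel.

(** * The arctangent kernel *)

Section arctan_kernel.
Variable K : realType.
Local Notation mu := (@lebesgue_measure K).
Implicit Types (e s t a x y : K).

Lemma Rdominated_cvg (D : set K) (f_ : nat -> K -> K) (f g : K -> K) :
  measurable D -> (forall n, measurable_fun D (f_ n)) ->
  (forall x, D x -> f_ n x @[n --> \oo] --> f x) ->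
  mu.-integrable D (EFin \o g) ->
  (forall n x, D x -> `|f_ n x| <= g x) ->
  \int[mu]_(x in D) f_ n x @[n --> \oo] --> \int[mu]_(x in D) f x.
Proof.
move=> mD mf_ f_f ig f_g.
have mf : measurable_fun D f by exact: measurable_fun_cvg mf_ f_f.
have [|||||if_ _ h] := @dominated_convergence _ _ _ mu D mD (fun n => EFin \o f_ n)
  (EFin \o f) (EFin \o g).
- by move=> n; apply/measurable_EFinP; exact: mf_.
- by apply/measurable_EFinP; exact: mf.
- apply: aeW => x Dx; apply: cvg_EFin; first exact: nearW.
  exact: f_f.
- exact: ig.
- by apply: aeW => x n Dx; rewrite lee_fin f_g.
apply: fine_cvg; rewrite fineK//.
exact: integrable_fin_num.
Qed.

Lemma Rintegral_FTC (f F : K -> K) a : 0 <= a -> continuous f ->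
  (forall x, is_derive x 1 F (f x)) -> \int[mu]_(x in `[0, a]) f x = F a - F 0.
Proof.
rewrite le_eqVlt => /predU1P[<- _ _|a0 cf dF].
  by rewrite set_itv1 Rintegral_set1 subrr.
rewrite /Rintegral (@continuous_FTC2 _ f F 0 a a0)//.
- exact: continuous_subspaceT.
- have cF : continuous F.
    by move=> x; apply: differentiable_continuous; apply/derivable1_diffP; have [] := dF x.
  split.
  + by move=> x _; have [] := dF x.
  + by apply: cvg_at_right_filter; exact: cF.
  + by apply: cvg_at_left_filter; exact: cF.
- by move=> x _; rewrite derive1E; have h := dF x; exact: derive_val.
Qed.

Lemma norm_sin_le a : `|sin a| <= `|a|.
Proof.
wlog a0 : a / 0 <= a.
  move=> h; have [/h//|/ltW] := leP 0 a.
  by rewrite -oppr_ge0 => /h; rewrite sinN !normrN.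
have [|c _] := @MVT_segment _ sin cos 0 a a0.
  by apply: continuous_subspaceT => x; exact: continuous_sin.
by rewrite sin0 !subr0 => ->; rewrite normrM ler_piMl// cos_max.
Qed.

Lemma sin_div_le a t : 0 < t -> `|sin (a * t) / t| <= `|a|.
Proof.
move=> t0; rewrite normrM normfV (gtr0_norm t0) ler_pdivrMr//.
by rewrite (le_trans (norm_sin_le _))// normrM (gtr0_norm t0).
Qed.

Lemma measurable_sin_div a : measurable_fun setT (fun t : K => sin (a * t) / t).
Proof.
by apply: measurable_funM; [exact: measurable_sin_lin|exact: measurable_invr].
Qed.

Lemma sin_div_integral a t : 0 <= a -> 0 < t ->
  sin (a * t) / t = \int[mu]_(s in `[0, a]) cos (s * t).
Proof.
move=> a0 t0.
have cf : continuous (fun s : K => cos (s * t)).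
  by move=> s; apply: continuous_comp; [exact: mulrr_continuous|exact: continuous_cos].
have dF (s : K) : is_derive s 1 (fun s : K => t^-1 * sin (t * s)) (cos (s * t)).
  have d1 : is_derive s 1 (fun s => sin (t * s)) (t * cos (t * s)).
    exact: is_derive_comp_lin.
  have := @is_deriveZ _ _ _ _ t^-1 s 1 _ d1.
  by rewrite /GRing.scale/= mulrA mulVf ?gt_eqF// mul1r (mulrC t).
by rewrite (Rintegral_FTC a0 cf dF) mulr0 sin0 mulr0 subr0 mulrC (mulrC t).
Qed.

Lemma integrable_abel_sin e a : 0 < e ->
  mu.-integrable `]0, +oo[ (EFin \o (fun t => expR (- e * t) * (sin (a * t) / t))).
Proof.
move=> e0; apply: (@integrable_le _ _ _ (fun t => `|a| * expR (- e * t))) => //.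
- apply: measurable_funTS; apply: measurable_funM; first exact: measurable_exp_lin.
  exact: measurable_sin_div.
- apply: integrable_mull => //; apply: integrableS (integrable_exp_lin e0) => //.
  by apply: subset_itvr; rewrite bnd_simp.
- move=> t /=; rewrite in_itv/= andbT => t0.
  by rewrite normrM ger0_norm ?expR_ge0// mulrC ler_wpM2r ?expR_ge0// sin_div_le.
Qed.

(** sin(at)/t is the integral of cos(st) for s in [0, a]. After Fubini's theorem the integral in t
    is e / (e^2 + s^2), the derivative of atan(s/e) in s. *)
Lemma Rintegral_abel_sin_ge0 e a : 0 < e -> 0 <= a ->
  \int[mu]_(t in `]0, +oo[) (expR (- e * t) * (sin (a * t) / t)) = atan (e^-1 * a).
Proof.
move=> e0 a0.
have en0 : e != 0 by rewrite gt_eqF.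
transitivity (\int[mu]_(t in `]0, +oo[) \int[mu]_(s in `[0, a]) (expR (- e * t) * cos (s * t))).
  apply: eq_Rintegral => t; rewrite inE/= in_itv/= andbT => t0.
  rewrite RintegralZl//; first by rewrite sin_div_integral.
  apply: (@integrable_bounded _ _ _ 1) => //; first exact: lebesgue_measure_itv_lty.
    by apply: measurable_funTS; exact: measurable_cosM.
  by move=> s _; exact: cos_max.
have mexp := @measurable_exp_lin K e.
rewrite (@Rfubini _ _ _ _ _ _ _ (fun t => expR (- e * t)) (cst 1))//.
- transitivity (\int[mu]_(s in `[0, a]) (e / (e ^+ 2 + s ^+ 2))).
    apply: eq_Rintegral => s _; rewrite -Rintegral_exp_cos//.
    rewrite Rintegral_itv_obnd_cbnd//.
    apply: (@integrable_le _ _ _ (fun t => expR (- e * t))) => //.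
    + by apply: measurable_funTS; apply: measurable_funM => //; exact: measurable_cos_lin.
    + apply: integrableS (integrable_exp_lin e0) => //.
      by apply: subset_itvr; rewrite bnd_simp.
    + by move=> t _; rewrite normrM ger0_norm ?expR_ge0// ler_piMr ?expR_ge0// cos_max.
  have es0 s : e ^+ 2 + s ^+ 2 != 0 by rewrite gt_eqF// ltr_pwDl// ?exprn_gt0// sqr_ge0.
  have cf : continuous (fun s => e / (e ^+ 2 + s ^+ 2)).
    move=> s; apply: cvgM; first exact: cvg_cst.
    apply: cvgV => //; apply: cvgD; first exact: cvg_cst.
    exact: exprn_continuous.
  have dF s : is_derive s 1 (fun s => atan (e^-1 * s)) (e / (e ^+ 2 + s ^+ 2)).
    have := @is_derive_comp_lin _ _ _ e^-1 s (is_derive1_atan (e^-1 * s)).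
    rewrite (_ : e^-1 * _^-1 = e / (e ^+ 2 + s ^+ 2))//.
    have es1 : 1 + (e^-1 * s) ^+ 2 != 0 by rewrite gt_eqF// ltr_pwDl// sqr_ge0.
    have -> : 1 + (e^-1 * s) ^+ 2 = (e ^+ 2 + s ^+ 2) / e ^+ 2 by field.
    by field; rewrite en0 es0.
  by rewrite (Rintegral_FTC a0 cf dF) mulr0 atan0 subr0.
- apply: measurable_funM; first exact: (measurableT_comp mexp).
  apply: measurableT_comp; last exact: measurable_funM.
  by apply: continuous_measurable_fun; exact: continuous_cos.
- apply: integrableS (integrable_exp_lin e0) => //.
  by apply: subset_itvr; rewrite bnd_simp.
- apply: (@integrable_bounded _ _ _ 1) => //; first exact: lebesgue_measure_itv_lty.
  by move=> x _; rewrite normr1.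
- by move=> t s _ _; rewrite normrM ger0_norm ?expR_ge0// ler_wpM2l ?expR_ge0// cos_max.
Qed.

Lemma Rintegral_abel_sin e a : 0 < e ->
  \int[mu]_(t in `]0, +oo[) (expR (- e * t) * (sin (a * t) / t)) = atan (e^-1 * a).
Proof.
move=> e0; have [a0|a0] := leP 0 a; first exact: Rintegral_abel_sin_ge0.
have Na0 : 0 <= - a by lra.
have := Rintegral_abel_sin_ge0 e0 Na0.
rewrite mulrN atanN.
have -> : \int[mu]_(t in `]0, +oo[) (expR (- e * t) * (sin (- a * t) / t)) =
    - 1 * \int[mu]_(t in `]0, +oo[) (expR (- e * t) * (sin (a * t) / t)).
  rewrite -RintegralZl//; last exact: integrable_abel_sin.
  by apply: eq_Rintegral => t _; rewrite (mulNr a t) sinN; ring.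
by lra.
Qed.

(** The two terms come from sin(xt) cos(yt) = (sin((x + y)t) + sin((x - y)t)) / 2. *)
Definition abel_kernel e x y := (atan (e^-1 * (x + y)) + atan (e^-1 * (x - y))) / 2.

Lemma Rintegral_abel_sin_cos e x y : 0 < e ->
  \int[mu]_(t in `]0, +oo[) (expR (- e * t) * (sin (x * t) / t) * cos (y * t)) =
  abel_kernel e x y.
Proof.
move=> e0; rewrite /abel_kernel -!Rintegral_abel_sin//.
rewrite -RintegralD//; [|exact: integrable_abel_sin|exact: integrable_abel_sin].
rewrite mulrC -RintegralZl//; last first.
  by apply: integrable_add => //; exact: integrable_abel_sin.
apply: eq_Rintegral => t _.
have -> : (x + y) * t = x * t + y * t by ring.
have -> : (x - y) * t = x * t - y * t by ring.
(* The identity is linear in [t^-1]; abstracting it spares [field] the condition t != 0. *)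
by rewrite sinD sinB; set i := t^-1; field.
Qed.

Lemma abel_kernel_le e x y : `|abel_kernel e x y| <= pi / 2.
Proof.
have := atan_gtNpi2 (e^-1 * (x + y)); have := atan_ltpi2 (e^-1 * (x + y)).
have := atan_gtNpi2 (e^-1 * (x - y)); have := atan_ltpi2 (e^-1 * (x - y)).
rewrite /abel_kernel ler_norml => *; apply/andP; split; lra.
Qed.

Lemma cvg_atan_gt0 a : 0 < a -> atan (n.+1%:R * a) @[n --> \oo] --> (pi / 2 : K).
Proof.
move=> a0; apply: (@cvg_comp _ _ _ _ (@atan K) _ (pinfty_nbhs K)); last exact: cvgy_atan.
apply: (@cvg_comp _ _ _ (fun n : nat => n.+1%:R) ( *%R^~ a) _ (pinfty_nbhs K)).
  apply/cvgryPge => A; near=> n; apply: le_trans (_ : n%:R <= _).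
    by near: n; exact: nbhs_infty_ger.
  by rewrite ler_nat.
exact: gt0_cvgMly.
Unshelve. all: by end_near. Qed.

(** The sign also covers y = x, where the limit is pi/4, so convergence holds at every point and not
    only almost everywhere. *)
Lemma cvg_abel_kernel x y : 0 < x -> 0 <= y ->
  abel_kernel n.+1%:R^-1 x y @[n --> \oo] --> ((1 + Num.sg (x - y)) * (pi / 4) : K).
Proof.
move=> x0 y0; rewrite /abel_kernel.
under eq_fun do rewrite invrK.
have h1 : atan (n.+1%:R * (x + y)) @[n --> \oo] --> (pi / 2 : K) by apply: cvg_atan_gt0; lra.
have h2 : atan (n.+1%:R * (x - y)) @[n --> \oo] --> (Num.sg (x - y) * (pi / 2) : K).
  have [xy|xy|xy] := ltgtP 0 (x - y).
  - by rewrite gtr0_sg// mul1r; exact: cvg_atan_gt0.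
  - rewrite ltr0_sg// mulN1r.
    rewrite (_ : (fun n : nat => _) = (fun n : nat => - atan (n.+1%:R * (y - x)))).
      by apply: cvgN; apply: cvg_atan_gt0; lra.
    by apply/funext => n; rewrite -atanN -mulrN opprB.
  - rewrite -xy sgr0 mul0r; under eq_fun do rewrite mulr0 atan0.
    exact: cvg_cst.
rewrite (_ : _ * (pi / 4) = (pi / 2 + Num.sg (x - y) * (pi / 2)) / 2); last by field.
by apply: cvgM; [exact: cvgD|exact: cvg_cst].
Qed.

End arctan_kernel.

(** * Inversion formula for x > 0 *)

Section inversion.
Variable K : realType.
Local Notation mu := (@lebesgue_measure K).
Variables (rho : K -> K).
Hypothesis (irho : mu.-integrable setT (EFin \o rho)).
Let mrho : measurable_fun setT rho. Proof. exact: integrable_measurable_real irho. Qed.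
Let irho0 : mu.-integrable `[0, +oo[ (EFin \o (fun y => `|rho y|)).
Proof. by apply: integrable_norm; exact: integrableS irho. Qed.

Lemma Rintegral_abel_cosT (e x : K) : 0 < e -> 0 <= x ->
  \int[mu]_(t in `]0, +oo[) (expR (- e * t) * (sin (x * t) / t) * cosT rho t) =
  \int[mu]_(y in `[0, +oo[) (rho y * abel_kernel e x y).
Proof.
move=> e0 x0.
pose f (t y : K) := expR (- e * t) * (sin (x * t) / t) * (rho y * cos (y * t)).
have mA : measurable_fun setT (fun t : K => expR (- e * t) * (sin (x * t) / t)).
  by apply: measurable_funM; [exact: measurable_exp_lin|exact: measurable_sin_div].
(* As |sin(xt)/t| <= x, the integrand is dominated by a product of integrable functions of [t] and
   [y], as [Rfubini] requires. *)
have f_le t y : 0 < t -> `|f t y| <= (x * expR (- e * t)) * `|rho y|.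
  move=> t0; rewrite /f !normrM (ger0_norm (expR_ge0 _)) -normrM.
  rewrite ler_pM// ?mulr_ge0 ?expR_ge0//.
    by rewrite mulrC ler_wpM2r ?expR_ge0// (le_trans (sin_div_le _ t0))// ger0_norm.
  by rewrite ler_piMr// cos_max.
transitivity (\int[mu]_(t in `]0, +oo[) \int[mu]_(y in `[0, +oo[) f t y).
  apply: eq_Rintegral => t _; rewrite RintegralZl//.
  exact: integrable_Mcos.
rewrite (@Rfubini _ _ _ _ _ _ _ (fun t => x * expR (- e * t)) (fun y => `|rho y|))//.
- apply: eq_Rintegral => y _; rewrite -Rintegral_abel_sin_cos//.
  rewrite -RintegralZl//; last first.
    apply: (@integrable_le _ _ _ (fun t => x * expR (- e * t))) => //.
    + apply: measurable_funTS; apply: measurable_funM => //; exact: measurable_cos_lin.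
    + apply: integrable_mull => //; apply: integrableS (integrable_exp_lin e0) => //.
      by apply: subset_itvr; rewrite bnd_simp.
    + move=> t /=; rewrite in_itv/= andbT => t0.
      rewrite !normrM (ger0_norm (expR_ge0 _)) -normrM.
      rewrite -[leRHS]mulr1 ler_pM// ?mulr_ge0 ?expR_ge0 ?cos_max//.
      by rewrite mulrC ler_wpM2r ?expR_ge0// (le_trans (sin_div_le _ t0))// ger0_norm.
  by apply: eq_Rintegral => t _; rewrite /f; ring.
- apply: measurable_funM; first exact: (measurableT_comp mA).
  apply: measurable_funM; first exact: (measurableT_comp mrho).
  apply: measurableT_comp; last exact: measurable_funM.
  by apply: continuous_measurable_fun; exact: continuous_cos.
- apply: integrable_mull => //; apply: integrableS (integrable_exp_lin e0) => //.
  by apply: subset_itvr; rewrite bnd_simp.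
- by move=> t y /=; rewrite in_itv/= andbT => t0 _; exact: f_le.
Qed.

Lemma measurable_atan : measurable_fun setT (@atan K).
Proof. by apply: continuous_measurable_fun => x; exact: continuous_atan. Qed.

Lemma measurable_abel_kernel (e x : K) : measurable_fun setT (abel_kernel e x).
Proof.
have mlin : forall s : K, measurable_fun setT (fun y : K => atan (e^-1 * (x + s * y))).
  move=> s; apply: measurableT_comp; first exact: measurable_atan.
  by apply: measurable_funM => //; apply: measurable_funD => //; exact: measurable_funM.
rewrite (_ : abel_kernel e x =
    (fun y => (atan (e^-1 * (x + 1 * y)) + atan (e^-1 * (x + -1 * y))) * 2^-1)).
  by apply: measurable_funM => //; apply: measurable_funD; exact: mlin.
by apply/funext => y; rewrite /abel_kernel mul1r mulN1r.
Qed.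

Lemma cosT_inversion (x : K) : 0 < x ->
  mu.-integrable `]0, +oo[ (EFin \o (fun t => cosT rho t / t)) ->
  \int[mu]_(t in `]0, +oo[) (cosT rho t / t * sin (x * t)) =
  pi / 2 * \int[mu]_(y in `[0, x]) rho y.
Proof.
move=> x0 iG.
pose eps (n : nat) : K := n.+1%:R^-1.
have eps0 n : 0 < eps n by rewrite invr_gt0.
have lhs : \int[mu]_(t in `]0, +oo[) (expR (- eps n * t) * (sin (x * t) / t) * cosT rho t)
    @[n --> \oo] --> \int[mu]_(t in `]0, +oo[) (cosT rho t / t * sin (x * t)).
  apply: (@Rdominated_cvg _ _ _ _ (fun t => `|cosT rho t / t|)) => //.
  - move=> n; apply: measurable_funTS; apply: measurable_funM; last exact: measurable_cosT.
    by apply: measurable_funM; [exact: measurable_exp_lin|exact: measurable_sin_div].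
  - move=> t _.
    rewrite (_ : cosT rho t / t * sin (x * t) = expR (- 0 * t) * (sin (x * t) / t) * cosT rho t).
      apply: cvgM; last exact: cvg_cst.
      apply: cvgM; last exact: cvg_cst.
      apply: continuous_cvg; first exact: continuous_expR.
      apply: cvgM; last exact: cvg_cst.
      by apply: cvgN; exact: cvg_harmonic.
    by rewrite oppr0 mul0r expR0; ring.
  - exact: integrable_norm.
  - move=> n t /=; rewrite in_itv/= andbT => t0.
    rewrite (_ : _ * cosT rho t = (expR (- eps n * t) * sin (x * t)) * (cosT rho t / t)); last by ring.
    rewrite normrM ler_piMl// normrM ger0_norm ?expR_ge0//.
    rewrite mulr_ile1 ?expR_ge0 ?sin_max//.
    by rewrite -expR0 ler_expR mulNr oppr_le0 mulr_ge0// ltW.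
have rhs : \int[mu]_(y in `[0, +oo[) (rho y * abel_kernel (eps n) x y)
    @[n --> \oo] --> \int[mu]_(y in `[0, +oo[) (rho y * ((1 + Num.sg (x - y)) * (pi / 4))).
  apply: (@Rdominated_cvg _ _ _ _ (fun y => pi / 2 * `|rho y|)) => //.
  - move=> n; apply: measurable_funTS; apply: measurable_funM => //.
    exact: measurable_abel_kernel.
  - move=> y /=; rewrite in_itv/= andbT => y0.
    by apply: cvgM; [exact: cvg_cst|exact: cvg_abel_kernel].
  - exact: integrable_mull.
  - by move=> n y _; rewrite normrM mulrC ler_wpM2r// abel_kernel_le.
have -> : \int[mu]_(t in `]0, +oo[) (cosT rho t / t * sin (x * t)) =
    \int[mu]_(y in `[0, +oo[) (rho y * ((1 + Num.sg (x - y)) * (pi / 4))).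
  apply: (cvg_unique _ lhs); first exact: Rhausdorff.
  rewrite (_ : (fun n : nat => _) = (fun n : nat =>
      \int[mu]_(y in `[0, +oo[) (rho y * abel_kernel (eps n) x y))).
    exact: rhs.
  by apply/funext => n; exact: Rintegral_abel_cosT (ltW x0).
have ik : mu.-integrable `[0, +oo[ (EFin \o (fun y => rho y * ((1 + Num.sg (x - y)) * (pi / 4)))).
  apply: (@integrable_le _ _ _ (fun y => pi / 2 * `|rho y|)) => //.
  - apply: measurable_funTS; apply: measurable_funM => //.
    apply: measurable_funM => //; apply: measurable_funD => //.
    rewrite (_ : (fun y : K => Num.sg (x - y)) =
      (fun y => \1_`]-oo, x[%classic y - \1_`]x, +oo[%classic y)).
      by apply: measurable_funB; exact: measurable_indic.
    apply/funext => y; rewrite !indicE.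
    have [xy|xy|<-] := ltgtP x y.
    + rewrite ltr0_sg ?subr_lt0// memNset/=; last by rewrite in_itv/=; lra.
      by rewrite mem_set/= ?sub0r// in_itv/= andbT.
    + rewrite gtr0_sg ?subr_gt0// mem_set/=; last by rewrite in_itv/= xy.
      by rewrite memNset/= ?subr0// in_itv/= andbT; lra.
    + by rewrite subrr sgr0 !memNset/= ?subrr// in_itv/= ltxx.
  - exact: integrable_mull.
  - move=> y _; rewrite normrM mulrC ler_wpM2r//.
    have p0 := pi_gt0 K.
    rewrite normrM (ger0_norm (_ : 0 <= pi / 4)); last lra.
    rewrite (_ : pi / 2 = 2 * (pi / 4)); last by field.
    rewrite ler_pM2r; last lra.
    by case: sgrP => _; rewrite ?addr0 ?normr1 ?subrr ?normr0 ?ger0_norm; lra.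
have := @Rintegral_itvB _ _ (BLeft 0) (BInfty _ false) x ik.
rewrite !bnd_simp => /(_ (ltW x0) isT).
have -> : \int[mu]_(y in `]x, +oo[) (rho y * ((1 + Num.sg (x - y)) * (pi / 4))) = 0.
  rewrite /Rintegral integral0_eq// => y /=; rewrite in_itv/= andbT => xy.
  by rewrite ltr0_sg ?subr_lt0// subrr mul0r mulr0.
move/eqP; rewrite subr_eq0 => /eqP ->.
(* At y = x the factor is pi/4 instead of pi/2, so this endpoint is removed on both sides. *)
rewrite -Rintegral_itv_bndo_bndc; last first.
  by apply: integrableS ik => //; apply: subset_itvl.
rewrite -[in RHS]Rintegral_itv_bndo_bndc; last by exact: integrableS irho.
rewrite -RintegralZl//; last by exact: integrableS irho.
apply: eq_Rintegral => y; rewrite inE/= in_itv/= => /andP[y0 yx].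
by rewrite gtr0_sg ?subr_gt0//; field.
Qed.

End inversion.

(** * Integrals of even and odd functions *)

Section symmetric.
Variable K : realType.
Local Notation mu := (@lebesgue_measure K).
Variables (g : K -> K) (c : K).
Hypotheses (mg : measurable_fun setT g) (gN : forall x, g (- x) = c * g x)
  (ig : mu.-integrable `]0, +oo[ (EFin \o g)).

Let oppE : -%R @^-1` `]0, +oo[%classic = `]-oo, 0[%classic :> set K.
Proof. by apply/seteqP; split => x /=; rewrite !in_itv/= ?andbT oppr_gt0. Qed.

Let mgN : measurable_fun setT (fun x : K => g (- x)).
Proof. by under eq_fun do rewrite gN; exact: measurable_funM. Qed.

Let igN : mu.-integrable `]0, +oo[ (EFin \o (fun x : K => g (- x))).
Proof.
have := integrable_mull c (measurable_itv `]0, +oo[) ig.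
by apply: eq_integrable => // x _ /=; rewrite gN.
Qed.

Let igneg : mu.-integrable `]-oo, 0[ (EFin \o g).
Proof.
have := integrable_reflection (measurable_itv `]0, +oo[) mgN igN.
by rewrite oppE; apply: eq_integrable => // x _ /=; rewrite opprK.
Qed.

(** The factor [c] treats even functions (c = 1) and odd functions (c = -1) at once. *)
Lemma integrable_symmetric : mu.-integrable setT (EFin \o g).
Proof. exact: integrable_setT_split. Qed.

Lemma Rintegral_symmetric :
  \int[mu]_x g x = (1 + c) * \int[mu]_(x in `]0, +oo[) g x.
Proof.
have := @Rintegral_itvB _ g (BInfty _ true) (BInfty _ false) 0.
rewrite set_itvNyy => /(_ integrable_symmetric isT isT) h.
have h2 : \int[mu]_(x in `]-oo, 0]) g x = c * \int[mu]_(x in `]0, +oo[) g x.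
  rewrite -Rintegral_itv_bndo_bndc; last exact: igneg.
  rewrite -RintegralZl//.
  have := Rintegral_reflection (measurable_itv `]0, +oo[) mgN igN.
  rewrite oppE => h3.
  transitivity (\int[mu]_(x in `]-oo, 0[) g (- - x)).
    by apply: eq_Rintegral => x _; rewrite opprK.
  by rewrite h3; apply: eq_Rintegral => x _; rewrite gN.
by rewrite mulrDl mul1r -h2 -h subrK.
Qed.

End symmetric.

(** * Sine representation of a real odd function *)

Section sine_representation.
Variable K : realType.
Local Notation mu := (@lebesgue_measure K).
Variables (rho V r : K -> K) (b : K).
Hypotheses (irho : mu.-integrable setT (EFin \o rho)) (b0 : 0 <= b)
  (V_ni : forall x y, x <= y -> V y <= V x) (V_ge0 : forall x, 0 <= V x)
  (iV : mu.-integrable `[b, +oo[ (EFin \o V))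
  (rhoV : forall x y, b <= x -> x <= y -> `|rho x - rho y| <= V x - V y)
  (r_odd : forall x, r (- x) = - r x)
  (rE : forall x, 0 < x -> r x = \int[mu]_(y in `[0, x]) rho y)
  (ir : mu.-integrable `]0, +oo[ (EFin \o (fun u => r u / u)))
  (ihead : mu.-integrable `[1, +oo[
     (EFin \o (fun t => (\int[mu]_(x in `[0, b]) (rho x * cos (x * t))) / t))).

Lemma sine_representation : exists phi : K -> K,
  [/\ mu.-integrable setT (EFin \o phi), forall t, phi (- t) = - phi t &
    forall x, r x = (Num.sqrt (2 * pi))^-1 * \int[mu]_t (phi t * sin (x * t))].
Proof.
have iG : mu.-integrable `]0, +oo[ (EFin \o (fun t => cosT rho t / t)).
  apply: (integrable_cosT_div irho b0 V_ni V_ge0 iV rhoV) => //.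
  move: ir; apply: eq_integrable => // u; rewrite inE/= in_itv/= andbT => u0.
  by rewrite rE.
(* [c] is sqrt(2/pi): with the prefactor 1/sqrt(2 pi), the doubling by evenness and the pi/2 of the
   inversion formula, the constants multiply to 1. *)
pose c : K := Num.sqrt (2 * pi) / pi.
have mG : measurable_fun setT (fun t : K => c * (cosT rho t / t)).
  apply: measurable_funM => //.
  by apply: measurable_funM; [exact: measurable_cosT|exact: measurable_invr].
have GN t : cosT rho (- t) = cosT rho t.
  by apply: eq_Rintegral => x _; rewrite mulrN cosN.
exists (fun t => c * (cosT rho t / t)); split.
- apply: (@integrable_symmetric _ _ (-1)) => //.
    by move=> t; rewrite GN invrN; ring.
  exact: integrable_mull.
- by move=> t; rewrite GN invrN; ring.
(* Both sides are odd in [x], so the inversion formula for x > 0 suffices. *)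
move=> x; wlog x0 : x / 0 < x.
  move=> H; have [x0|x0|<-] := ltgtP 0 x.
  - exact: H.
  - have Nx0 : 0 < - x by lra.
    rewrite -[x in LHS]opprK r_odd (H _ Nx0) -mulrN; congr (_ * _).
    rewrite -mulN1r -RintegralZl//; last first.
      apply: (@integrable_le _ _ _ (fun t => `|c * (cosT rho t / t)|)) => //.
      + by apply: measurable_funM => //; exact: measurable_sin_lin.
      + apply: integrable_norm; apply: (@integrable_symmetric _ _ (-1)) => //.
          by move=> t; rewrite GN invrN; ring.
        exact: integrable_mull.
      + by move=> t _; rewrite normrM ler_piMr// sin_max.
    by apply: eq_Rintegral => t _; rewrite (mulNr x t) sinN; ring.
  - under eq_Rintegral do rewrite mul0r sin0 mulr0.
    rewrite Rintegral_cst// mul0r mulr0.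
    have := r_odd 0; rewrite oppr0; lra.
rewrite (@Rintegral_symmetric _ _ 1).
- rewrite (_ : \int[mu]_(t in `]0, +oo[) _ =
      c * \int[mu]_(t in `]0, +oo[) (cosT rho t / t * sin (x * t))).
    rewrite (cosT_inversion irho x0 iG) -rE// /c.
    have p0 := pi_gt0 K.
    have s0 : 0 < Num.sqrt (2 * pi) :> K by rewrite sqrtr_gt0 mulr_gt0.
    move: s0; move: (pi : K) p0 => p p0 s0.
    by field; apply/andP; split; rewrite gt_eqF.
  rewrite -RintegralZl//; last first.
    apply: (@integrable_le _ _ _ (fun t => `|cosT rho t / t|)) => //.
    + apply: measurable_funTS; apply: measurable_funM; last exact: measurable_sin_lin.
      by apply: measurable_funM; [exact: measurable_cosT|exact: measurable_invr].
    + exact: integrable_norm.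
    + by move=> t _; rewrite normrM ler_piMr// sin_max.
  by apply: eq_Rintegral => t _; ring.
- by apply: measurable_funM => //; exact: measurable_sin_lin.
- by move=> t; rewrite GN invrN (mulrN x t) sinN; ring.
- apply: (@integrable_le _ _ _ (fun t => `|c * (cosT rho t / t)|)) => //.
  + by apply: measurable_funTS; apply: measurable_funM => //; exact: measurable_sin_lin.
  + by apply: integrable_norm; exact: integrable_mull.
  + by move=> t _; rewrite normrM ler_piMr// sin_max.
Qed.

End sine_representation.

(** * Complex-valued functions *)

From mathcomp Require Import complex.
Import ComplexField.Normc.

(** * Absolute continuity of the components *)

Section abs_continuous_real.
Variable K : realType.
Local Notation mu := (@lebesgue_measure K).
Variables (R : K -> K[i]) (p : K[i] -> K).
Hypothesis p_le : forall z w, `|p z - p w| <= normc (z - w).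
Let r x := p (R x).

Lemma clamp_lipschitz (a x y : K) : x <= y -> clamp a y - clamp a x <= y - x.
Proof.
by move=> xy; rewrite /clamp; case: (leP y a); case: (leP x a) => ? ?;
  case: (leP 0 x) => ?; case: (leP 0 y) => ?; case: (leP 0 a) => ?; lra.
Qed.

Lemma clamp_id (a x : K) : 0 <= x <= a -> clamp a x = x.
Proof. by move=> /andP[x0 xa]; rewrite /clamp (min_idPl xa) (max_idPr x0). Qed.

Lemma clampK (a x : K) : 0 < a -> clamp a (clamp a x) = clamp a x.
Proof. by move=> a0; rewrite clamp_id// clamp_ge0 clamp_le// ltW. Qed.

(** [abs_continuousC] speaks of nondegenerate disjoint intervals in [0, a]. Clamping a chain brings
    it into [0, a] without lengthening it; the intervals that collapse to a point contribute nothing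
    and are filtered out. *)
Lemma abs_continuousC_clamp (a : K) : 0 < a -> abs_continuousC 0 a R ->
  abs_continuous (fun x => r (clamp a x)).
Proof.
move=> a0 acR e e0; have [d d0 dP] := acR _ e0; exists d => // lo L hi cL lenL.
pose L' := [seq (clamp a q.1, clamp a q.2) | q <- L].
pose L'' := [seq q <- L' | q.1 < q.2].
have cL' := chain_map (clamp_homo a) cL.
have prL'' : pairwise (fun q q' : K * K => q.2 <= q'.1) L''.
  exact/pairwise_filter/(chain_pairwise cL').
have LP q : q \in L'' -> [/\ 0 <= q.1, q.1 < q.2 & q.2 <= a].
  rewrite mem_filter => /andP[q12 /mapP[q' _ q'E]]; split => //.
    by rewrite q'E /= clamp_ge0.
  by rewrite q'E /= clamp_le// ltW.
pose u (i : 'I_(size L'')) := (nth (0, 0) L'' i).1.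
pose v (i : 'I_(size L'')) := (nth (0, 0) L'' i).2.
have := dP _ u v.
have sumE (g : K * K -> K) : \sum_(i < size L'') g (nth (0, 0) L'' i) = \sum_(q <- L'') g q.
  by rewrite [RHS](big_nth (0, 0)) big_mkord.
rewrite (sumE (fun q => q.2 - q.1)) (sumE (fun q => normc (R q.2 - R q.1))) => h.
rewrite (@le_lt_trans _ _ (\sum_(q <- L'') normc (R q.2 - R q.1)))//.
  rewrite [leRHS]big_filter [leRHS]big_mkcond big_map/= /chain_var.
  rewrite big_seq [leRHS]big_seq; apply: ler_sum => q qL /=; case: ifPn => [_|].
    exact: p_le.
  rewrite -leNgt => q21.
  have q12 := clamp_homo a (chain_ordered cL qL).
  by rewrite (_ : clamp a q.2 = clamp a q.1) ?subrr ?normr0//; apply/eqP; rewrite eq_le q12 q21.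
apply: h.
- by move=> i; apply: LP; exact: mem_nth.
- apply/trivIsetP => i j _ _.
  wlog ij : i j / (i < j)%N.
    move=> H; rewrite neq_ltn => /orP[ij|ji]; first by apply: H => //; rewrite neq_ltn ij.
    by rewrite setIC; apply: H => //; rewrite neq_ltn ji.
  move=> _; rewrite -subset0 => x [] /=; rewrite !in_itv/= => /andP[_ xv] /andP[ux _].
  have /(pairwiseP (0, 0)) /(_ i j) := prL''.
  rewrite !inE !ltn_ord => /(_ isT isT ij); rewrite -/(u j) -/(v i) => h1.
  by have := lt_trans xv (le_lt_trans h1 ux); rewrite ltxx.
- apply: le_lt_trans lenL.
  rewrite big_filter big_mkcond big_map/= /chain_len.
  rewrite big_seq [leRHS]big_seq; apply: ler_sum => q qL /=.
  have := chain_ordered cL qL => q12.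
  case: ifPn => _; [exact: clamp_lipschitz|by rewrite subr_ge0].
Qed.

(** Near x > 0, [r] coincides with its cutoff at n + 1 as soon as x < n + 1; the exceptional sets of
    these countably many cutoffs have a null union. *)
Lemma abs_continuousC_ae_derivable : (forall a, 0 < a -> abs_continuousC 0 a R) ->
  {ae mu, forall x, 0 < x -> derivable r x 1}.
Proof.
move=> acR.
have : {ae mu, forall x n, derivable (fun x => r (clamp n.+1%:R x)) x 1}.
  apply: ae_foralln => n.
  have n0 : 0 < n.+1%:R :> K by [].
  have [|w iw wE] := abs_continuous_integral (ltW n0) (abs_continuousC_clamp n0 (acR _ n0)).
    by move=> x; rewrite clampK.
  have := ae_derivable_indefinite iw wE.
  by apply: filterS; [exact: (ae_filter_ringOfSetsType mu)|move=> x []].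
apply: filterS; first exact: (ae_filter_ringOfSetsType mu).
move=> x dr x0.
have [n xn] : exists n, x < n.+1%:R.
  exists (Num.bound x); rewrite -natr1.
  by have := archi_boundP (ltW x0); lra.
apply: near_eq_derivable (dr n).
near=> y; rewrite clamp_id//; apply/andP; split.
  by apply: ltW; near: y; exact: lt_nbhsr.
by apply: ltW; near: y; exact: lt_nbhsl.
Unshelve. all: by end_near. Qed.

Lemma abs_continuousC_FTC : (forall a, 0 < a -> abs_continuousC 0 a R) ->
  mu.-integrable `]0, +oo[ (EFin \o derive1 r) ->
  forall x, 0 <= x -> r x - r 0 = \int[mu]_(t in `]0, x]) derive1 r t.
Proof.
move=> acR ir' x; rewrite le_eqVlt => /predU1P[<-|x0].
  by rewrite subrr set_itvoc0 Rintegral_set0.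
(* Cutting off beyond [x] gives every point of ]0, x], including [x] itself, a neighbourhood on
   which the cutoff changes nothing. *)
pose a := x + 1; have a0 : 0 < a by rewrite /a; lra.
have [|w iw wE] := abs_continuous_integral (ltW a0) (abs_continuousC_clamp a0 (acR _ a0)).
  by move=> y; rewrite clampK.
have := wE 0 x (ltW x0); rewrite !clamp_id//; try (rewrite /a; lra).
move=> ->.
congr fine; apply: ae_eq_integral => //.
- by apply/measurable_int/integrableS/iw.
- by apply/measurable_int/(integrableS _ _ _ ir') => //; exact: subset_itvl.
have := ae_derivable_indefinite iw wE.
apply: filterS; first exact: (ae_filter_ringOfSetsType mu).
move=> y [dw <-]; rewrite /= in_itv/= => /andP[y0 yx].
congr EFin; rewrite !derive1E; apply: near_eq_derive.
near=> z; rewrite clamp_id//; apply/andP; split.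
  by apply: ltW; near: z; exact: lt_nbhsr.
apply: ltW; near: z; apply: lt_nbhsl; rewrite /a; lra.
Unshelve. all: by end_near. Qed.

End abs_continuous_real.

(** * Modulus and total variation on a half-line *)

Section complex_complements.
Variable K : realType.
Implicit Types (z w : K[i]) (D : K -> K[i]).

Lemma normcE z : normc z = Num.sqrt (complex.Re z ^+ 2 + complex.Im z ^+ 2).
Proof. by case: z. Qed.

Lemma norm_Re_le z : `|complex.Re z| <= normc z.
Proof. by rewrite normcE -sqrtr_sqr ler_sqrt ?lerDl ?addr_ge0 ?sqr_ge0. Qed.

Lemma norm_Im_le z : `|complex.Im z| <= normc z.
Proof. by rewrite normcE -sqrtr_sqr ler_sqrt ?lerDr ?addr_ge0 ?sqr_ge0. Qed.

Lemma norm_ReB_le z w : `|complex.Re z - complex.Re w| <= normc (z - w).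
Proof. by rewrite -raddfB norm_Re_le. Qed.

Lemma norm_ImB_le z w : `|complex.Im z - complex.Im w| <= normc (z - w).
Proof. by rewrite -raddfB norm_Im_le. Qed.

Lemma normcE_ge0 z : 0 <= normc z.
Proof. by rewrite normcE sqrtr_ge0. Qed.

Lemma total_variationC_pinfty_ge0 D x : (0 <= total_variationC_pinfty x D)%E.
Proof.
apply: (@le_trans _ _ (total_variationC x x D)); last first.
  by apply: ereal_sup_ubound; exists x => //=; rewrite in_itv/= lexx.
apply: ereal_sup_ubound; exists [::]; first by split => //=.
by rewrite /variationC big_nil.
Qed.

(** Putting [y] in front of a partition of [y, c] gives a partition of [x, c] with the increment
    from [x] to [y] as an additional term. This yields both the monotonicity of the variation and
    its control of increments. *)
Lemma total_variationC_pinfty_le D x y : x <= y ->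
  ((normc (D y - D x))%:E + total_variationC_pinfty y D <=
    total_variationC_pinfty x D)%E.
Proof.
rewrite le_eqVlt => /predU1P[<-|xy].
  by rewrite subrr normc0 add0e.
rewrite -leeBrDl//; apply: ge_ereal_sup => _ [c yc <-].
apply: ge_ereal_sup => _ [s [ys slast] <-].
rewrite leeBrDl// -EFinD.
apply: (@le_trans _ _ (total_variationC x c D)); last first.
  apply: ereal_sup_ubound; exists c => //.
  by move: yc; rewrite /= !in_itv/= !andbT; apply: le_trans; exact: ltW.
apply: ereal_sup_ubound; exists (y :: s); first by split => //=; rewrite xy.
by rewrite /variationC/= big_nat_recl.
Qed.

End complex_complements.

(** * Representation of one component *)

Section component.
Variable K : realType.
Local Notation mu := (@lebesgue_measure K).
(* p is the real or the imaginary part. *)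
Variables (R D : K -> K[i]) (p : K[i] -> K) (b : K).
Hypotheses (p_le : forall z w, `|p z - p w| <= normc (z - w))
  (pN : forall z, p (- z) = - p z)
  (acR : forall a, 0 < a -> abs_continuousC 0 a R)
  (R_odd : forall x, R (- x) = - R x)
  (b0 : 0 <= b)
  (ir' : mu.-integrable `]0, +oo[ (EFin \o derive1 (p \o R)))
  (ir : mu.-integrable `]0, +oo[ (EFin \o (fun u => p (R u) / u)))
  (ihead : mu.-integrable `[1, +oo[ (EFin \o (fun t =>
     (\int[mu]_(x in `[0, b]) (derive1 (p \o R) x * cos (x * t))) / t)))
  (Dae : {ae mu, forall x, 0 < x -> p (D x) = derive1 (p \o R) x})
  (Dvar : (total_variationC_pinfty b D < +oo)%E)
  (iDvar : (\int[mu]_(x in `[b, +oo[) total_variationC_pinfty x D < +oo)%E).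

(** Made constant on ]-oo, b], so that it is finite and nonincreasing on the whole line. *)
Let V x := fine (total_variationC_pinfty (Num.max x b) D).

Let varD_fin x : b <= x -> total_variationC_pinfty x D \is a fin_num.
Proof.
move=> bx; rewrite ge0_fin_numE ?total_variationC_pinfty_ge0//.
apply: le_lt_trans Dvar; apply: le_trans (total_variationC_pinfty_le D bx).
by rewrite leeDr// lee_fin normcE_ge0.
Qed.

Let VE x : b <= x -> (V x)%:E = total_variationC_pinfty x D.
Proof. by move=> bx; rewrite /V (max_idPl bx) fineK// varD_fin. Qed.

Let V_ge0 x : 0 <= V x.
Proof. exact/fine_ge0/total_variationC_pinfty_ge0. Qed.

Let DV x y : b <= x -> x <= y -> normc (D y - D x) <= V x - V y.
Proof.
move=> bx xy; rewrite lerBrDr -lee_fin EFinD !VE//; last exact: le_trans xy.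
exact: total_variationC_pinfty_le.
Qed.

Let V_ni x y : x <= y -> V y <= V x.
Proof.
move=> xy; apply: fine_le; rewrite ?varD_fin ?le_max ?lexx ?orbT//.
have mxy : Num.max x b <= Num.max y b.
  by rewrite ge_max !le_max xy lexx orbT.
apply: le_trans (total_variationC_pinfty_le D mxy).
by rewrite leeDr// lee_fin normcE_ge0.
Qed.

Let iV : mu.-integrable `[b, +oo[ (EFin \o V).
Proof.
apply/integrableP; split.
  by apply/measurable_EFinP; apply: nonincreasing_measurable => // x y; exact: V_ni.
apply: le_lt_trans iDvar; rewrite le_eqVlt; apply/orP; left; apply/eqP.
apply: eq_integral => x; rewrite inE/= in_itv/= andbT => bx.
by rewrite /= ger0_norm ?VE.
Qed.

Let r' : K -> K := derive1 (p \o R).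

(* A version of r' that inherits the bounded variation of D on [b, +oo[. *)
Let rho x := if b <= x then p (D x) else if 0 < x then r' x else 0.

Let rhoV x y : b <= x -> x <= y -> `|rho x - rho y| <= V x - V y.
Proof.
move=> bx xy; rewrite /rho bx (le_trans bx xy) distrC.
by apply: (le_trans (p_le _ _)); exact: DV.
Qed.

Let rho_ae : ae_eq mu `]0, +oo[%classic r' rho.
Proof.
move: Dae; apply: filterS; first exact: (ae_filter_ringOfSetsType mu).
move=> x h; rewrite /= in_itv/= andbT => x0.
by rewrite /rho x0 h//; case: ifP.
Qed.

Let mrho : measurable_fun (`]0, +oo[%classic : set K) rho.
Proof.
have mr' : measurable_fun (`]0, +oo[%classic : set K) r' by exact: integrable_measurable_real ir'.
have mV : measurable_fun setT V by apply: nonincreasing_measurable => // x y; exact: V_ni.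
(* q is nonincreasing, hence measurable; this gives the measurability of p \o D
   on [b, +oo[. *)
pose q x := p (D (Num.max x b)) + V x.
have mq : measurable_fun setT q.
  apply: nonincreasing_measurable => // x y xy; rewrite /q.
  have mxy : Num.max x b <= Num.max y b.
    by rewrite ge_max !le_max xy lexx orbT.
  have bm : b <= Num.max x b by rewrite le_max lexx orbT.
  have := DV bm mxy; rewrite /V.
  rewrite !(max_idPl (_ : b <= Num.max _ b)) ?le_max ?lexx ?orbT// => h.
  have := p_le (D (Num.max y b)) (D (Num.max x b)).
  by rewrite ler_norml => /andP[]; lra.
have mqV : measurable_fun (`]0, +oo[%classic : set K) (q \- V).
  by apply: measurable_funTS; exact: measurable_funB.
apply: (@eq_measurable_fun _ _ _ _ _ (fun x => if b <= x then (q \- V) x else r' x)).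
  move=> x; rewrite inE/= in_itv/= andbT => x0; rewrite /rho x0.
  by case: ifPn => // bx; rewrite /= /q addrK (max_idPl bx).
apply: measurable_fun_if => //.
- exact: measurable_fun_ler.
- by apply: measurable_funS mqV => // x [].
- by apply: measurable_funS mr' => // x [].
Qed.

Let irho0 : mu.-integrable `]0, +oo[ (EFin \o rho).
Proof.
have /integrableP[mr' ioo] := ir'.
apply/integrableP; split; first by apply/measurable_EFinP.
apply: le_lt_trans ioo; rewrite le_eqVlt; apply/orP; left; apply/eqP.
apply: ae_eq_integral => //.
- by apply: measurableT_comp => //; exact/measurable_EFinP.
- exact: measurableT_comp.
exact: (ae_eq_comp (fun y : K => `|y%:E|%E) (ae_eq_sym rho_ae)).
Qed.

Let irho : mu.-integrable setT (EFin \o rho).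
Proof.
have ineg : mu.-integrable `]-oo, 0[ (EFin \o rho).
  apply: (@eq_integrable _ _ _ _ _ _ (cst 0)%E) => //; last exact: integrable0.
  move=> x; rewrite inE/= in_itv/= => x0; rewrite /rho.
  have -> : (b <= x) = false by apply/negbTE; rewrite -ltNge (lt_le_trans x0 b0).
  by have -> : (0 < x) = false by apply/negbTE; rewrite -leNgt ltW.
exact: integrable_setT_split.
Qed.

(** Serves for h = 1 and for a cosine. The point 0 is dropped because [rho] is compared with [r'] on
    ]0, +oo[ only. *)
Let ae_Rintegral (u : K) (h : K -> K) : measurable_fun setT h ->
  (forall x, `|h x| <= 1) ->
  \int[mu]_(x in `[0, u]) (rho x * h x) = \int[mu]_(x in `]0, u]) (r' x * h x).
Proof.
move=> mh h1.
rewrite -Rintegral_itv_obnd_cbnd; last first.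
  apply: (@integrable_le _ _ _ (fun x => `|rho x|)) => //.
  - apply: measurable_funTS; apply: measurable_funM => //; exact: integrable_measurable_real irho.
  - apply: integrable_norm; exact: integrableS irho.
  - by move=> x _; rewrite normrM ler_piMr.
have sub : (`]0, u]%classic : set K) `<=` `]0, +oo[%classic.
  by apply: subset_itvl.
congr fine; apply: ae_eq_integral => //.
- apply/measurable_EFinP; apply: measurable_funTS; apply: measurable_funM => //.
  exact: integrable_measurable_real irho.
- apply/measurable_EFinP; apply: measurable_funM; last exact: measurable_funTS.
  by have := integrable_measurable_real ir'; exact: measurable_funS.
- case: rho_ae => N [mN N0 sN]; exists N; split => // x /= H; apply: sN => /= H'.
  by apply: H => /sub /H' ->.
Qed.

Lemma component_representation : exists phi : K -> K,
  [/\ mu.-integrable setT (EFin \o phi), forall t, phi (- t) = - phi t &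
    forall x, p (R x) = (Num.sqrt (2 * pi))^-1 * \int[mu]_t (phi t * sin (x * t))].
Proof.
have pR_odd x : p (R (- x)) = - p (R x) by rewrite R_odd pN.
have pR0 : p (R 0) = 0 by have := pR_odd 0; rewrite oppr0; lra.
apply: (sine_representation irho b0 V_ni V_ge0 iV rhoV pR_odd) => //.
- move=> x x0.
  have := abs_continuousC_FTC p_le acR ir' (ltW x0).
  rewrite pR0 subr0 => ->.
  transitivity (\int[mu]_(y in `[0, x]) (rho y * cst 1 y)).
    rewrite ae_Rintegral//; last by move=> ?; rewrite normr1.
    by apply: eq_Rintegral => t _; rewrite mulr1.
  by apply: eq_Rintegral => t _; rewrite mulr1.
- apply: eq_integrable ihead => // t _ /=; congr (_ / _)%:E.
  rewrite (ae_Rintegral _ (measurable_cosM t))//; last by move=> ?; exact: cos_max.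
  rewrite Rintegral_itv_obnd_cbnd//.
  apply: (@integrable_le _ _ _ (fun x => `|r' x|)) => //.
  + apply: measurable_funM; last by apply: measurable_funTS; exact: measurable_cosM.
    have := integrable_measurable_real ir'; apply: measurable_funS => //.
    by apply: subset_itvl.
  + apply: integrable_norm; apply: integrableS ir' => //.
    by apply: subset_itvl.
  + by move=> x _; rewrite normrM ler_piMr// cos_max.
Qed.

End component.

(** * From components back to complex functions *)

Section complex_integrability.
Variable K : realType.
Local Notation mu := (@lebesgue_measure K).

(** The cutoffs at n + 1 are continuous on the whole line and, at each x > 0, eventually equal to
    the function. *)
Lemma measurable_abs_continuousC (R : K -> K[i]) (p : K[i] -> K) :
  (forall z w, `|p z - p w| <= normc (z - w)) ->
  (forall a, 0 < a -> abs_continuousC 0 a R) ->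
  measurable_fun (`]0, +oo[%classic : set K) (fun x => p (R x)).
Proof.
move=> p_le acR.
apply: (@measurable_fun_cvg _ _ _ _ (fun n x => p (R (clamp n.+1%:R x)))).
  move=> n; apply: measurable_funTS; apply: continuous_measurable_fun.
  have n0 : 0 < n.+1%:R :> K by [].
  exact: abs_continuous_continuous (abs_continuousC_clamp p_le n0 (acR _ n0)).
move=> x /=; rewrite in_itv/= andbT => x0; apply: cvg_near_cst.
near=> n; rewrite clamp_id// ltW//=.
apply: (@le_trans _ _ n%:R); last by rewrite ler_nat.
by near: n; exact: nbhs_infty_ger.
Unshelve. all: by end_near. Qed.

Lemma integrable_normc_div (A : set K) (F : K -> K[i]) :
  measurable A -> A `<=` `]0, +oo[%classic ->
  measurable_fun A (fun x => complex.Re (F x)) ->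
  measurable_fun A (fun x => complex.Im (F x)) ->
  (\int[mu]_(x in A) (normc (F x) / x)%:E < +oo)%E ->
  mu.-integrable A (EFin \o (fun x => complex.Re (F x) / x)) /\
  mu.-integrable A (EFin \o (fun x => complex.Im (F x) / x)).
Proof.
move=> mA A0 mRe mIm ioo.
have minv : measurable_fun A (@GRing.inv K) by apply: measurable_funTS; exact: measurable_invr.
have mnorm : measurable_fun A (fun x => normc (F x) / x).
  apply: measurable_funM => //; under eq_fun do rewrite normcE.
  apply: measurableT_comp.
    by apply: continuous_measurable_fun; exact: sqrt_continuous.
  by apply: measurable_funD; exact: measurable_funX.
have inorm : mu.-integrable A (EFin \o (fun x => normc (F x) / x)).
  apply/integrableP; split; first exact/measurable_EFinP.
  apply: le_lt_trans ioo; rewrite le_eqVlt; apply/orP; left; apply/eqP.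
  apply: eq_integral => x /set_mem /A0; rewrite /= in_itv/= andbT => x0.
  by rewrite ger0_norm// mulr_ge0 ?normcE_ge0 ?invr_ge0 ?ltW.
have x_gt0 x : A x -> 0 < x by move=> /A0; rewrite /= in_itv/= andbT.
split; apply: (@integrable_le _ _ _ (fun x => normc (F x) / x)) => //.
- exact: measurable_funM.
- move=> x /x_gt0 x0; rewrite normrM normfV (gtr0_norm x0).
  by rewrite ler_wpM2r ?invr_ge0 ?(ltW x0)// norm_Re_le.
- exact: measurable_funM.
- move=> x /x_gt0 x0; rewrite normrM normfV (gtr0_norm x0).
  by rewrite ler_wpM2r ?invr_ge0 ?(ltW x0)// norm_Im_le.
Qed.

(** The function transformed is i (phi1 + i phi2). The cosine integrals vanish by oddness, and the
    factor i cancels the -i in front of the sine integrals. *)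
Lemma fourier_sine (phi1 phi2 : K -> K) (x : K) :
  mu.-integrable setT (EFin \o phi1) -> mu.-integrable setT (EFin \o phi2) ->
  (forall t, phi1 (- t) = - phi1 t) -> (forall t, phi2 (- t) = - phi2 t) ->
  fourier (fun t => Complex (- phi2 t) (phi1 t)) x =
  Complex ((Num.sqrt (2 * pi))^-1 * \int[mu]_t (phi1 t * sin (x * t)))
          ((Num.sqrt (2 * pi))^-1 * \int[mu]_t (phi2 t * sin (x * t))).
Proof.
move=> i1 i2 o1 o2.
have m1 := integrable_measurable_real i1; have m2 := integrable_measurable_real i2.
have ic (phi : K -> K) : mu.-integrable setT (EFin \o phi) ->
    mu.-integrable setT (EFin \o (fun t => phi t * cos (x * t))).
  move=> iphi; apply: (@integrable_le _ _ _ (fun t => `|phi t|)) => //.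
  - apply: measurable_funM; last exact: measurable_cos_lin.
    exact: integrable_measurable_real iphi.
  - exact: integrable_norm.
  - by move=> t _; rewrite normrM ler_piMr// cos_max.
have is_ (phi : K -> K) : mu.-integrable setT (EFin \o phi) ->
    mu.-integrable setT (EFin \o (fun t => phi t * sin (x * t))).
  move=> iphi; apply: (@integrable_le _ _ _ (fun t => `|phi t|)) => //.
  - apply: measurable_funM; last exact: measurable_sin_lin.
    exact: integrable_measurable_real iphi.
  - exact: integrable_norm.
  - by move=> t _; rewrite normrM ler_piMr// sin_max.
have c0 (phi : K -> K) : mu.-integrable setT (EFin \o phi) -> (forall t, phi (- t) = - phi t) ->
    \int[mu]_t (phi t * cos (x * t)) = 0.
  move=> iphi ophi; rewrite (@Rintegral_symmetric _ _ (-1)).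
  - by rewrite subrr mul0r.
  - apply: measurable_funM; last exact: measurable_cos_lin.
    exact: integrable_measurable_real iphi.
  - by move=> t; rewrite ophi (mulrN x t) cosN; ring.
  - exact: integrableS (ic _ iphi).
rewrite /fourier /integralC.
have -> : \int[mu]_t complex.Re (Complex (- phi2 t) (phi1 t) * expi (- (x * t))) =
    \int[mu]_t (phi1 t * sin (x * t)).
  rewrite -[RHS]subr0 -(c0 _ i2 o2) -RintegralB//; [|exact: is_|exact: ic].
  by apply: eq_Rintegral => t _; rewrite /= cosN sinN; ring.
have -> : \int[mu]_t complex.Im (Complex (- phi2 t) (phi1 t) * expi (- (x * t))) =
    \int[mu]_t (phi2 t * sin (x * t)).
  rewrite -[RHS]addr0 -(c0 _ i1 o1) -RintegralD//; [|exact: is_|exact: ic].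
  by apply: eq_Rintegral => t _; rewrite /= cosN sinN; ring.
by apply/eqP; rewrite eq_complex /= !mul0r subr0 addr0 !eqxx.
Qed.

End complex_integrability.

Theorem mainTheorem2 (K : realType) (R : K -> K[i])
  (R_odd : forall x, R (- x) = - R x)
  (R_0 : R 0 = 0)
  (R_cvg0 : R x @[x --> +oo] --> (0 : (K[i])^o))
  (R_divx : (\int[lebesgue_measure]_(x in `]0%R, +oo[)
                (normc (R x) / x)%:E < +oo)%E)
  (R_ac : forall a : K, 0 < a -> abs_continuousC 0 a R)
  (R'_L1 : integrableC `]0, +oo[ (derive1C R))
  (R_6 : exists2 b : K, 0 <= b &
     let g := fun t : K =>
       integralC `[0, b] (fun x => derive1C R x * real_complex K (cos (x * t))) in
     (\int[lebesgue_measure]_(t in `[1%R, +oo[) (normc (g t) / t)%:E < +oo)%E /\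
     exists D : K -> K[i],
       [/\ forall x, derivableC R x -> D x = derive1C R x,
           (total_variationC_pinfty b D < +oo)%E &
           (\int[lebesgue_measure]_(x in `[b, +oo[)
               total_variationC_pinfty x D < +oo)%E]) :
  fourier_algebra R.
Proof.
case: R_6 => b b0 /= [gdiv [D [DR Dvar iDvar]]].
pose g (t : K) := integralC `[0, b] (fun x => derive1C R x * real_complex K (cos (x * t))).
pose re : K[i] -> K := @complex.Re K; pose im : K[i] -> K := @complex.Im K.
have [iRe' iIm'] := R'_L1.
have aeRe := abs_continuousC_ae_derivable (@norm_ReB_le K) R_ac.
have aeIm := abs_continuousC_ae_derivable (@norm_ImB_le K) R_ac.
have ae' : {ae lebesgue_measure, forall x : K, 0 < x -> derivableC R x}.
  have [N1 [mN1 N10 sN1]] := aeRe; have [N2 [mN2 N20 sN2]] := aeIm.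
  exists (N1 `|` N2); split; first exact: measurableU.
    exact: null_set_setU.
  move=> x /= H; apply: contrapT => /not_orP[n1 n2]; apply: H => x0; split.
    by apply: contrapT => nd; apply: n1; apply: sN1 => /(_ x0).
  by apply: contrapT => nd; apply: n2; apply: sN2 => /(_ x0).
have [irRe irIm] : lebesgue_measure.-integrable `]0, +oo[ (EFin \o (fun x => re (R x) / x)) /\
    lebesgue_measure.-integrable `]0, +oo[ (EFin \o (fun x => im (R x) / x)).
  apply: integrable_normc_div => //; apply: measurable_abs_continuousC => //.
  - exact: norm_ReB_le.
  - exact: norm_ImB_le.
have ReG t : complex.Re (g t) =
    \int[lebesgue_measure]_(x in `[0, b]) (derive1 (re \o R) x * cos (x * t)).
  by apply: eq_Rintegral => x _ /=; rewrite mulr0 subr0.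
have ImG t : complex.Im (g t) =
    \int[lebesgue_measure]_(x in `[0, b]) (derive1 (im \o R) x * cos (x * t)).
  by apply: eq_Rintegral => x _ /=; rewrite mulr0 add0r.
have mG (p : K[i] -> K) : lebesgue_measure.-integrable `]0, +oo[ (EFin \o derive1 (p \o R)) ->
    measurable_fun (`[1, +oo[%classic : set K) (fun t =>
    \int[lebesgue_measure]_(x in `[0, b]) (derive1 (p \o R) x * cos (x * t))).
  move=> ip'; apply: measurable_funTS.
  (* Integrability is known on ]0, +oo[ only, so [0, b] is replaced by ]0, b], on which the integral
     depends continuously on [t]. *)
  have ipb : lebesgue_measure.-integrable `]0, b] (EFin \o derive1 (p \o R)).
    by apply: integrableS ip' => //; exact: subset_itvl.
  apply: continuous_measurable_fun.
  rewrite (_ : (fun t => _) = (fun t : K =>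
      \int[lebesgue_measure]_(x in `]0, b]) (derive1 (p \o R) x * cos (x * t)))).
    exact: continuous_Rintegral_cos.
  apply/funext => t; rewrite Rintegral_itv_obnd_cbnd//.
  apply: (@integrable_le _ _ _ (fun x => `|derive1 (p \o R) x|)) => //.
  - apply: measurable_funM; last by apply: measurable_funTS; exact: measurable_cosM.
    exact: integrable_measurable_real ipb.
  - exact: integrable_norm.
  - by move=> x _; rewrite normrM ler_piMr// cos_max.
have [ihRe ihIm] :
    lebesgue_measure.-integrable `[1, +oo[ (EFin \o (fun t => complex.Re (g t) / t)) /\
    lebesgue_measure.-integrable `[1, +oo[ (EFin \o (fun t => complex.Im (g t) / t)).
  apply: (@integrable_normc_div _ _ g); last exact: gdiv.
  - exact: measurable_itv.
  - by apply: subset_itvr; rewrite bnd_simp.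
  - by apply: eq_measurable_fun (mG re iRe') => t _; exact/esym/ReG.
  - by apply: eq_measurable_fun (mG im iIm') => t _; exact/esym/ImG.
(* [D] is prescribed where both components are derivable, which by [ae'] is almost everywhere on ]0,
   +oo[. *)
have aeD (p : K[i] -> K) : (forall x, p (derive1C R x) = derive1 (p \o R) x) ->
    {ae lebesgue_measure, forall x : K, 0 < x -> p (D x) = derive1 (p \o R) x}.
  move=> pd; have [N [mN N0 sN]] := ae'; exists N; split => // x /= H; apply: sN.
  by move=> /= H'; apply: H => /H' /DR ->.
have [||phi1 [i1 o1 e1]] := component_representation (@norm_ReB_le K)
  (fun z => raddfN _ z) R_ac R_odd b0 iRe' irRe _ _ Dvar iDvar.
- by apply: eq_integrable ihRe => // t _; congr (_ / _)%:E; exact: ReG.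
- exact: aeD.
have [||phi2 [i2 o2 e2]] := component_representation (@norm_ImB_le K)
  (fun z => raddfN _ z) R_ac R_odd b0 iIm' irIm _ _ Dvar iDvar.
- by apply: eq_integrable ihIm => // t _; congr (_ / _)%:E; exact: ImG.
- exact: aeD.
exists (fun t => Complex (- phi2 t) (phi1 t)).
  split => //=.
  have := integrable_mull (-1) measurableT i2.
  by apply: eq_integrable => // t _ /=; rewrite mulN1r.
move=> x; rewrite fourier_sine// -e1 -e2.
by rewrite /re /im; case: (R x).
Qed.
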